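(* Let $n=2^t+m$ with integers $t\ge 0$ and $0\le m<2^t$. Let $k,\ell$ be integers with $0\le k<\ell\le t$ and $2^k+2^\ell\le n$. Then the following equivalence holds, with the exception of the case $n=6$, $k=0$, $\ell=1$ (in which it fails): $f_kf_\ell=f_\ell f_k$ as maps from the set of odd partitions of $n$ to the set of odd partitions of $n-2^k-2^\ell$ (i.e. $f_k^{n-2^\ell}\circ f_\ell^n=f_\ell^{n-2^k}\circ f_k^n$) if and only if $2^k>m$ or $\ell=t$.
   Context: For a partition $\lambda$ of $n$, $\chi^\lambda$ is the corresponding irreducible complex character of the symmetric group $\mathfrak{S}_n$; $\lambda$ is called odd if $\chi^\lambda$ has odd degree. The empty partition is considered odd. For $2^k\le n$, the map $f_k^n$ from odd partitions of $n$ to odd partitions of $n-2^k$ is defined as follows: for an odd partition $\lambda$ of $n$ there is exactly one $2^k$-hook of $\lambda$ whose removal leaves an odd partition of $n-2^k$ (known result), and $f_k^n(\lambda)$ is the resulting odd partition. Equivalently, on the level of characters, $\chi^{f_k^n(\lambda)}$ is the unique odd-degree irreducible constituent of the restriction of $\chi^\lambda$ to $\mathfrak{S}_{n-2^k}$ appearing with odd multiplicity. The upper index is omitted when clear, so $f_kf_\ell$ on odd partitions of $n$ means: first apply $f_\ell^n$, then $f_k^{n-2^\ell}$. *)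

(* Defs.v *)
From HB Require Import structures.
From mathcomp Require Import all_boot all_order all_algebra all_fingroup.
From mathcomp Require Import all_solvable all_field all_character.

Set Implicit Arguments.
Unset Strict Implicit.
Unset Printing Implicit Defensive.

Import GRing.Theory.

(* Rows and columns of Young diagrams are numbered from 0:                    *)
(* the box (r, c) belongs to the diagram of la iff c < nth 0 la r.            *)

Definition is_partition (n : nat) (la : seq nat) : bool :=
  [&& sorted geq la, 0 \notin la & sumn la == n].

Definition conj_part (la : seq nat) : seq nat :=
  mkseq (fun c => count (fun x => c < x) la) (head 0 la).

(* reshape_index la i is the index of the block containing i when             *)
(* 0, ..., n - 1 is cut into consecutive blocks of sizes la_0, la_1, ...      *)
Definition young_set (n : nat) (la : seq nat) : {set 'S_n} :=
  [set s : 'S_n | [forall i, reshape_index la (s i) == reshape_index la i]].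

Fact young_group_set n la : group_set (young_set n la).
Proof.
apply/group_setP; split=> [|s u]; first by rewrite inE; apply/forallP=> i; rewrite perm1.
rewrite !inE => /forallP Hs /forallP Hu; apply/forallP=> i.
by rewrite permM (eqP (Hu _)) (eqP (Hs _)).
Qed.
Canonical young_group n la := Group (young_group_set n la).

Fact sign_char_subproof n :
  is_class_fun <<[set: 'S_n]>>%g [ffun s : 'S_n => ((-1) ^+ odd_perm s)%R].
Proof.
rewrite genGid; apply: intro_class_fun => [s u _ _|s]; last by rewrite inE.
by rewrite odd_permJ.
Qed.
Definition sign_char n : 'CF([set: 'S_n]) := Cfun 1 (sign_char_subproof n).

(* The irreducible character chi^la of S_n labelled by the partition la of n: *)
(* by the classical theorem defining this labelling, 1 induced from the Young *)
(* subgroup of la and the sign induced from the Young subgroup of the         *)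
(* conjugate partition have exactly one irreducible constituent in common.    *)
(* Thus chi^(n) is trivial and chi^(1, ..., 1) is the sign.                   *)
Definition is_label (n : nat) (la : seq nat) (i : Iirr [set: 'S_n]) : bool :=
     (i \in irr_constt ('Ind[[set: 'S_n]] (1 : 'CF(young_group n la)))%R)
  && (i \in irr_constt ('Ind[[set: 'S_n]]
              ('Res[young_group n (conj_part la)] (sign_char n)))%R).

(* The default 0 is never reached when la is a partition of n. *)
Definition chi (n : nat) (la : seq nat) : 'CF([set: 'S_n]) :=
  ('chi_(odflt 0 [pick i | is_label la i]))%R.

(* Degrees are natural numbers, so the truncation loses nothing. *)
Definition odd_partition (n : nat) (la : seq nat) : bool :=
  is_partition n la && odd (Num.truncn (chi n la 1%g)).

Definition in_diagram (la : seq nat) (r c : nat) : bool := c < nth 0 la r.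

Definition boxes (la : seq nat) : seq (nat * nat) :=
  [seq (r, c) | r <- iota 0 (size la), c <- iota 0 (nth 0 la r)].

(* arm + leg + 1 *)
Definition hook_length (la : seq nat) (b : nat * nat) : nat :=
  (nth 0 la b.1 - b.2.+1) + (nth 0 (conj_part la) b.2 - b.1.+1) + 1.

(* The part of the rim associated with the hook at b: the boxes of the rim    *)
(* weakly below and weakly to the right of b.                                 *)
Definition in_rim_hook (la : seq nat) (b : nat * nat) (r c : nat) : bool :=
  [&& b.1 <= r, b.2 <= c, in_diagram la r c & ~~ in_diagram la r.+1 c.+1].

Definition remove_hook (la : seq nat) (b : nat * nat) : seq nat :=
  [seq x <- mkseq (fun r =>
     count (fun c => ~~ in_rim_hook la b r c) (iota 0 (nth 0 la r))) (size la)
   | 0 < x].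

(* f_k^n. For an odd partition la of n with 2^k <= n, exactly one hook passes *)
(* the filter, so head just extracts the single result; the default [::] is   *)
(* never reached.                                                             *)
Definition f (n k : nat) (la : seq nat) : seq nat :=
  head [::]
    [seq remove_hook la b | b <- boxes la
       & (hook_length la b == 2 ^ k)
         && odd_partition (n - 2 ^ k) (remove_hook la b)].

Definition f_commute (n k l : nat) : Prop :=
  forall la : seq nat, odd_partition n la ->
    f (n - 2 ^ l) k (f n l la) = f (n - 2 ^ k) l (f n k la).

(* Main.v *)
Require Import Defs.
From mathcomp Require Import all_boot all_order all_algebra all_fingroup.
From mathcomp Require Import all_solvable all_field all_character.
From mathcomp Require Import finmap zify.

(* Put beads at the numbers la_i + N - 1 - i: removing an h-hook moves a bead h places down to
   a free position. The alternating sum over w of the Young permutation characters of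
   la + delta - w delta is a virtual character of norm 1 that is not orthogonal to chi^la, so
   chi^la(1) is up to sign the coefficient of x^(la + delta) in a_delta(x) (x_1 + ... + x_N)^n.
   Modulo 2 the 2^k-th power of x_1 + ... + x_N is x_1^(2^k) + ... + x_N^(2^k), hence the parity
   of the degree is the sum of the parities over all removals of a 2^k-hook.
   For n = 2^t + m with m < 2^t, an odd partition thus is an odd partition Y of m, a 2^t-core,
   in which one bead p is lifted to p + 2^t. If k < t and 2^k <= m, then f_k acts on Y by f_k and
   moves p only if p interferes with the bead moved in Y; this gives the uniqueness of the odd
   child and f_k f_t = f_t f_k. If m < 2^k, then Y is even a 2^k-core, the lifted bead is a hook
   of size 2^(t-k) in the 2^k-quotient, parities are binomial coefficients of its leg length, and
   each of f_k, f_l clears one binary digit of the leg length, so they commute. In the remaining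
   cases explicit partitions with a hole at 0 separate f_k f_l from f_l f_k. *)

Set Implicit Arguments.
Unset Strict Implicit.
Unset Printing Implicit Defensive.

Import Order.TTheory GRing.Theory Num.Theory.

(** * Young permutation characters *)

(** The identification of the virtual character with plus or minus chi^la rests on dominance. A term
    with w different from 1 belongs to a composition one of whose partial sums exceeds that of la;
    triangularity of the coefficients then removes it from the norm, and the Gale-Ryser inequality
    makes it orthogonal to the signed Young character of the conjugate partition. Since [f] takes
    the head of a filtered list, uniqueness of the odd child is proved as well; it turns [f] into
    the relation [hook_step] between finite sets of beads. All sets reached from one partition have
    the same number of beads, so results of different orders are compared as sets. For m < 2^k both
    orders clear the same digits because 2^(t-k) - 2 - 2^(l-k), the upper index of the final
    binomial coefficient, has binary digit 0 at 0 and at l - k. The exception n = 6 arises because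
    the last family of counterexamples needs distinct beads 2^l + 2^k + 1 < 2^t, and there the two
    positions coincide. *)

Section YoungCharacters.
Variable n : nat.
Implicit Types (s u : seq nat) (g y : 'S_n).

Local Notation block s i := (reshape_index s (nat_of_ord i)).

Definition young_char s : 'CF([set: 'S_n]) := ('Ind[[set: 'S_n]] (1 : 'CF(young_group n s)))%R.
Definition signed_young_char s : 'CF([set: 'S_n]) :=
  ('Ind[[set: 'S_n]] ('Res[young_group n s] (sign_char n)))%R.

Lemma sign_charE g : (sign_char n g = (-1) ^+ odd_perm g)%R.
Proof. by rewrite cfunElock. Qed.

Lemma young_groupP s g :
  reflect (forall i, block s (g i) = block s i) (g \in young_group n s).
Proof. by rewrite inE; apply: (iffP forallP) => H i; apply/eqP. Qed.

Lemma young_groupJP s g y :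
  reflect (forall i, block s (y (g i)) = block s (y i)) (g ^ y \in young_group n s)%g.
Proof.
apply: (iffP (young_groupP _ _)) => H i.
  by have := H (y i); rewrite permJ.
by rewrite -{1}[i](permKV y) permJ H permKV.
Qed.

Local Open Scope ring_scope.

Lemma young_charE s g :
  young_char s g = #|young_group n s|%:R^-1 *
     \sum_(y : 'S_n) ((g ^ y)%g \in young_group n s)%:R.
Proof.
rewrite cfIndE ?subsetT //; congr (_ * _).
apply: eq_big => [y|y _]; [by rewrite inE|rewrite cfun1E]; reflexivity.
Qed.

Definition joint_stab s u y := (young_group n u :&: young_group n s :^ y^-1)%G.

Lemma in_joint_stab s u y g :
  (g \in joint_stab s u y) = (g \in young_group n u) && ((g ^ y)%g \in young_group n s).
Proof. by rewrite !inE mem_conjg invgK !inE. Qed.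

(** Mackey's formula, with all [y] in place of double coset representatives; [card_joint_fibre]
    later collects the equal terms. *)
Lemma cfdot_young_char s u :
  '[young_char s, young_char u] =
    (#|young_group n s| * #|young_group n u|)%:R^-1 * \sum_(y : 'S_n) #|joint_stab s u y|%:R.
Proof.
rewrite -cfdot_Res_l cfdotE natrM invfM [X in _ = X * _]mulrC -mulrA; congr (_ * _).
rewrite big_distrr /=.
under eq_bigr => g Hg do rewrite cfResE ?subsetT // young_charE cfun1E Hg conjC1 mulr1.
rewrite -!big_distrr /=; congr (_ * _); rewrite exchange_big /=.
apply: eq_bigr => y _; rewrite -sum1_card natr_sum /= [RHS]big_mkcond [LHS]big_mkcond /=.
apply: eq_bigr => g _; rewrite in_joint_stab.
by case: (g \in _) => //=; case: ifP => _; reflexivity.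
Qed.

Lemma cfdot_signed_young_char s u :
  '[young_char s, signed_young_char u] =
    (#|young_group n s| * #|young_group n u|)%:R^-1 *
      \sum_(y : 'S_n) \sum_(g in joint_stab s u y) (-1) ^+ odd_perm g.
Proof.
rewrite -cfdot_Res_l cfdotE natrM invfM [X in _ = X * _]mulrC -mulrA; congr (_ * _).
under eq_bigr => g Hg do rewrite !cfResE ?subsetT // young_charE sign_charE rmorph_sign -mulrA big_distrl /=.
rewrite -!big_distrr /=; congr (_ * _); rewrite exchange_big /=.
apply: eq_bigr => y _; rewrite [RHS]big_mkcond [LHS]big_mkcond /=.
apply: eq_bigr => g _; rewrite in_joint_stab.
by case: (g \in _) => //=; case: ifP => _; rewrite ?mul1r ?mul0r; reflexivity.
Qed.

(** Two points with the same pair of blocks give a transposition in the group, and multiplying by it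
    flips every sign. If all pairs differ, only the identity preserves them. *)
Lemma sum_sign_joint_stab s u y :
  \sum_(g in joint_stab s u y) (-1) ^+ odd_perm g =
    (injectiveb (fun i => (block s (y i), block u i)))%:R :> algC.
Proof.
have [inj|] := boolP (injectiveb _).
  rewrite (big_pred1 1%g) ?odd_perm1 // => g.
  apply/idP/eqP => [|->]; last exact: group1.
  rewrite in_joint_stab => /andP[/young_groupP Hu /young_groupJP Hs].
  apply/permP=> i; rewrite perm1; apply: (injectiveP _ inj) => /=.
  by rewrite Hu Hs.
move/injectivePn => [i [j ij [Es Eu]]].
set t := tperm i j.
have tL : t \in joint_stab s u y.
  rewrite in_joint_stab; apply/andP; split.
    by apply/young_groupP => x; rewrite /t; case: tpermP => // ->; rewrite ?Eu.
  by apply/young_groupJP => x; rewrite /t; case: tpermP => // ->; rewrite ?Es.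
set A := \sum_(g in _) _; suff : A = - A.
  by move/eqP; rewrite -addr_eq0 -mulr2n mulrn_eq0 /= => /eqP.
rewrite {1}/A (reindex_inj (mulgI t)) /= -sumrN; apply: eq_big => [g|g _].
  by rewrite groupMl.
by rewrite odd_permM odd_tperm ij signr_addb mulN1r.
Qed.

(** The inner product is a positive multiple of the number of such [y], so nothing can cancel. *)
Lemma cfdot_signed_neq0P s u :
  reflect (exists y : 'S_n, injective (fun i => (block s (y i), block u i)))
          ('[young_char s, signed_young_char u] != 0).
Proof.
rewrite cfdot_signed_young_char mulf_eq0 invr_eq0 pnatr_eq0 negb_or -lt0n muln_gt0 !cardG_gt0 /=.
under eq_bigr => y _ do rewrite sum_sign_joint_stab.
rewrite -natr_sum pnatr_eq0; apply: (iffP idP) => [|[y Hy]].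
  rewrite sum_nat_eq0 negb_forall => /existsP[y]; rewrite eqb0 negbK => /injectiveP Hy.
  by exists y.
rewrite sum_nat_eq0 negb_forall; apply/existsP; exists y; rewrite eqb0 negbK.
exact/injectiveP.
Qed.

End YoungCharacters.

(** * Inner products of Young characters as numbers of double cosets *)

Section JointTypes.
Variables (n N B : nat).
Hypothesis n_le_B : (n <= B)%N.
Implicit Types (s u : seq nat) (g y : 'S_n).

Local Notation block s i := (reshape_index s (nat_of_ord i)).

Definition joint_colouring s u y : n.-tuple (nat * nat) :=
  [tuple (block s (y i), block u i) | i < n].

(** The matrix of block intersections, stored by columns. A column has the finite type that exponent
    vectors have in the path counts, so that columns can later serve as steps of a path. *)
Definition joint_type s u y : (size u).-tuple {ffun 'I_N -> 'I_B.+1} :=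
  [tuple [ffun i : 'I_N => inord (count_mem (i : nat, j : nat) (joint_colouring s u y))] | j < size u].

Lemma joint_typeE s u y j i :
  tnth (joint_type s u y) j i = count_mem (i : nat, j : nat) (joint_colouring s u y) :> nat.
Proof.
rewrite tnth_mktuple ffunE inordK // ltnS (leq_trans (count_size _ _)) //.
by rewrite size_tuple.
Qed.

Lemma joint_colouring_perm s u y y' :
  perm_eq (joint_colouring s u y) (joint_colouring s u y') ->
  exists2 k, k \in young_group n u & exists2 h, h \in young_group n s & y = (k * y' * h)%g.
Proof.
case/tuple_permP => k Ek.
have {}Ek i : (block s (y i), block u i) = (block s (y' (k i)), block u (k i)).
  have := congr1 (fun t : n.-tuple _ => tnth t i) (val_inj Ek : joint_colouring s u y = _).
  by rewrite !tnth_mktuple.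
exists k; first by apply/young_groupP => i; case: (Ek i).
exists ((k * y')^-1 * y)%g; last by rewrite mulKVg.
apply/young_groupP => i; rewrite permM; set z := ((k * y')^-1)%g i.
have Ez : y' (k z) = i by rewrite -permM permKV.
by case: (Ek z) => -> _; rewrite Ez.
Qed.

Lemma joint_colouring_mul s u k y h :
  k \in young_group n u -> h \in young_group n s ->
  perm_eq (joint_colouring s u (k * y * h)%g) (joint_colouring s u y).
Proof.
move=> /young_groupP Hk /young_groupP Hh; apply/tuple_permP; exists k.
congr val; apply: eq_from_tnth => i; rewrite !tnth_mktuple !permM.
by rewrite Hh Hk.
Qed.

Lemma joint_type_inj s u y y' : sumn s = n -> sumn u = n -> size s = N ->
  joint_type s u y = joint_type s u y' ->
  perm_eq (joint_colouring s u y) (joint_colouring s u y').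
Proof.
move=> Hs Hu HN E; apply/allP => [[a b]] /=; rewrite mem_cat => Hab.
have [ha hb] : (a < N /\ b < size u)%N.
  have aux z : (a, b) \in joint_colouring s u z -> (a < N /\ b < size u)%N.
    by case/mapP => i _ [-> ->]; rewrite -HN !reshape_indexP ?Hs ?Hu.
  by case/orP: Hab; apply: aux.
have := joint_typeE s y (Ordinal hb) (Ordinal ha).
by rewrite E joint_typeE /= => ->.
Qed.

(* The fibres of [joint_type] are the double cosets of the two Young subgroups. *)
Lemma card_joint_fibre s u y0 : sumn s = n -> sumn u = n -> size s = N ->
  (#|[set y | joint_type s u y == joint_type s u y0]| * #|joint_stab s u y0| =
   #|young_group n s| * #|young_group n u|)%N.
Proof.
move=> Hs Hu HN.
have -> : [set y | joint_type s u y == joint_type s u y0] =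
          ((young_group n u * young_group n s :^ y0^-1) :* y0)%g.
  apply/setP => y; rewrite inE; apply/eqP/rcosetP => [E|[z /mulsgP[k h Hk Hh ->] ->]].
    have [k Hk [h Hh ->]] := joint_colouring_perm (joint_type_inj Hs Hu HN E).
    exists (k * (y0 * h * y0^-1))%g; last by rewrite !mulgA mulgKV.
    apply/mulsgP; exists k (y0 * h * y0^-1)%g => //.
    by rewrite mem_conjg invgK /conjg !mulgA mulVg mul1g mulgKV.
  move: Hh; rewrite mem_conjg invgK => Hh.
  have E := @joint_colouring_mul s u k y0 _ Hk Hh.
  have -> : (k * h * y0 = k * y0 * h ^ y0)%g by rewrite -!mulgA; congr (_ * _)%g; exact: conjgC.
  apply: eq_from_tnth => j; apply/ffunP => i; apply: ord_inj; rewrite !joint_typeE.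
  exact: (seq.permP E).
rewrite card_rcoset [RHS]mulnC -(cardJg (young_group n s) y0^-1).
by rewrite mul_cardG.
Qed.

Local Open Scope ring_scope.

(** In the Mackey sum every fibre of the type contributes the product of the two group orders, which
    the prefactor cancels. *)
Lemma cfdot_young_char_types s u : sumn s = n -> sumn u = n -> size s = N ->
  '[young_char n s, young_char n u] = #|joint_type s u @: [set: 'S_n]|%:R.
Proof.
move=> Hs Hu HN; rewrite cfdot_young_char -natr_sum.
suff -> : (\sum_(y : 'S_n) #|joint_stab s u y| =
   #|young_group n s| * #|young_group n u| * #|joint_type s u @: [set: 'S_n]|)%N.
  by rewrite [X in _ * X]natrM mulKf // pnatr_eq0 -lt0n muln_gt0 !cardG_gt0.
rewrite (partition_big (joint_type s u) (mem (joint_type s u @: [set: 'S_n]))) /=; last first.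
  by move=> y _; apply: imset_f; rewrite inE.
rewrite (eq_bigr (fun=> #|young_group n s| * #|young_group n u|)%N); first by rewrite sum_nat_const mulnC.
move=> _ /imsetP[y0 _ ->]; apply: etrans (card_joint_fibre y0 Hs Hu HN).
rewrite (eq_bigr (fun=> #|joint_stab s u y0|)); first by rewrite sum_nat_cond_const.
move=> y /eqP E; have := etrans (card_joint_fibre y Hs Hu HN) (esym (card_joint_fibre y0 Hs Hu HN)).
rewrite E => /eqP; rewrite eqn_pmul2l ?card_gt0; first by move/eqP.
by apply/set0Pn; exists y0; rewrite inE.
Qed.

End JointTypes.

Lemma map_reshape_index (s : seq nat) :
  [seq reshape_index s i | i <- iota 0 (sumn s)] =
  flatten [seq nseq (nth 0 s j) j | j <- iota 0 (size s)].
Proof.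
set ss := [seq nseq _ _ | _ <- _].
have Ess : shape ss = s.
  rewrite /shape -map_comp (eq_map (g := nth 0 s)) ?map_nth_iota0 ?take_size //.
  by move=> j /=; rewrite size_nseq.
apply: (@eq_from_nth _ 0); first by rewrite size_map size_iota size_flatten Ess.
move=> i; rewrite size_map size_iota => Hi.
rewrite (nth_map 0) ?size_iota // nth_iota // nth_flatten Ess add0n.
have Hr := reshape_indexP Hi.
by rewrite (nth_map 0) ?size_iota // nth_iota // add0n nth_nseq (reshape_offsetP Hi).
Qed.

Lemma count_reshape_index (s : seq nat) j :
  count_mem j [seq reshape_index s i | i <- iota 0 (sumn s)] = nth 0 s j.
Proof.
rewrite map_reshape_index count_flatten -map_comp sumnE big_map.
rewrite (eq_bigr (fun a => if a == j then nth 0 s a else 0)); last first.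
  by move=> a _ /=; rewrite count_nseq /=; case: eqP => _; rewrite ?mul1n.
have [lt_j|le_j] := ltnP j (size s); last first.
  rewrite nth_default // big_seq big1 // => a.
  by rewrite mem_iota add0n => /andP[_ Ha]; case: eqP => // E; move: Ha; rewrite E ltnNge le_j.
rewrite (bigD1_seq j) ?iota_uniq ?mem_iota //= eqxx big1 ?addn0 // => a.
by case: (a == j).
Qed.

(** * Double cosets as matrices with given row and column sums *)

Section Marginals.
Variables (n N B : nat).
Hypothesis n_le_B : (n <= B)%N.
Implicit Types (s u : seq nat) (g y : 'S_n).

Local Notation block s i := (reshape_index s (nat_of_ord i)).

Lemma block_count s y j : sumn s = n ->
  count_mem j [tuple block s (y i) | i < n] = nth 0 s j.
Proof.
move=> Hs; transitivity (count_mem j [tuple block s i | i < n]).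
  apply/seq.permP/tuple_permP; exists y; congr val.
  by apply: eq_from_tnth => i; rewrite !tnth_mktuple.
by rewrite -count_reshape_index Hs -val_enum_ord -map_comp.
Qed.

Lemma count_joint_colouring s u y (P : pred (nat * nat)) :
  count P (joint_colouring s u y) = #|[pred i : 'I_n | P (block s (y i), block u i)]|.
Proof. by rewrite count_map -sum1_count big_enum_cond /= sum1_card. Qed.

Lemma block_card s y j : sumn s = n -> #|[pred i : 'I_n | block s (y i) == j]| = nth 0 s j.
Proof. by move=> /(block_count y j) <-; rewrite count_map -sum1_count big_enum_cond /= sum1_card. Qed.

Definition marginals s u (M : (size u).-tuple {ffun 'I_N -> 'I_B.+1}) :=
  [forall j : 'I_(size u), (\sum_i tnth M j i)%N == nth 0 u j] &&
  [forall i : 'I_N, (\sum_j tnth M j i)%N == nth 0 s i].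

Lemma joint_type_marginals s u y : sumn s = n -> sumn u = n -> size s = N ->
  marginals s (joint_type N B s u y).
Proof.
move=> Hs Hu HN; apply/andP; split; apply/forallP => k; apply/eqP.
  have Hc (x : 'I_n) : (block s (y x) < N)%N by rewrite -HN reshape_indexP ?Hs.
  rewrite -(block_card 1 k Hu) -sum1_card (partition_big (fun x => Ordinal (Hc x)) xpredT) //=.
  apply: eq_bigr => i _; rewrite joint_typeE // count_joint_colouring -sum1_card.
  by apply: eq_bigl => x; rewrite !inE xpair_eqE perm1 andbC -val_eqE.
have Hd (x : 'I_n) : (block u x < size u)%N by rewrite reshape_indexP ?Hu.
rewrite -(block_card y k Hs) -sum1_card (partition_big (fun x => Ordinal (Hd x)) xpredT) //=.
apply: eq_bigr => i _; rewrite joint_typeE // count_joint_colouring -sum1_card.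
by apply: eq_bigl => x; rewrite !inE xpair_eqE -val_eqE.
Qed.

(** The list [z] contains each pair of block indices as often as [M] prescribes. The permutation [p]
    arranges it so that the second coordinates follow the blocks of [u]; then [y] sends every point
    into the block of [s] named by its first coordinate. *)
Lemma marginals_joint_type s u (M : (size u).-tuple {ffun 'I_N -> 'I_B.+1}) :
  sumn s = n -> sumn u = n -> size s = N -> marginals s M ->
  exists y, joint_type N B s u y = M.
Proof.
move=> Hs Hu HN /andP[/forallP Mu /forallP Ms].
pose z := flatten [seq nseq (tnth M p.1 p.2) (val p.2, val p.1) | p : 'I_(size u) * 'I_N].
have Cz P : count P z = (\sum_j \sum_i P (val i, val j) * tnth M j i)%N.
  rewrite /z count_flatten sumnE -map_comp big_map big_enum /= pair_bigA /=.
  by apply: eq_bigr => -[j i] _ /=; rewrite count_nseq.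
have Cz1 a : count_mem a (map fst z) = nth 0 s a.
  rewrite count_map Cz exchange_big /=; have [lt_a|le_a] := ltnP a N; last first.
    rewrite nth_default ?HN // big1 // => i _; rewrite big1 // => j _.
    by rewrite /=; case: eqP => // E; have := ltn_ord i; rewrite E ltnNge le_a.
  rewrite (bigD1 (Ordinal lt_a)) //= [X in (_ + X)%N]big1 ?addn0 => [|i Hi]; last first.
    by rewrite big1 // => j _; move: Hi; rewrite -val_eqE /= => /negbTE ->.
  by rewrite -(eqP (Ms (Ordinal lt_a))); apply: eq_bigr => j _; rewrite eqxx mul1n.
have Cz2 a : count_mem a (map snd z) = nth 0 u a.
  rewrite count_map Cz; have [lt_a|le_a] := ltnP a (size u); last first.
    rewrite nth_default // big1 // => i _; rewrite big1 // => j _.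
    by rewrite /=; case: eqP => //= E; have := ltn_ord i; rewrite E ltnNge le_a.
  rewrite (bigD1 (Ordinal lt_a)) //= [X in (_ + X)%N]big1 ?addn0 => [|i Hi]; last first.
    by rewrite big1 // => j _; move: Hi; rewrite -val_eqE /= => /negbTE ->.
  by rewrite -(eqP (Mu (Ordinal lt_a))); apply: eq_bigr => j _; rewrite eqxx mul1n.
have P2 : perm_eq [tuple block u i | i < n] (map snd z).
  apply/allP => a _ /=; rewrite Cz2; apply/eqP.
  by rewrite -(block_count 1 a Hu); congr (count_mem _ _); apply: eq_map => i; rewrite perm1.
have sz : size z = n by rewrite -(size_map snd) -(perm_size P2) size_tuple.
pose zt : n.-tuple (nat * nat) := tcast sz (in_tuple z).
have Ezt : val zt = z by rewrite [LHS]val_tcast.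
have [p Ep] : exists p : 'S_n, [tuple block u i | i < n] = [tuple (tnth zt (p i)).2 | i < n].
  have /tuple_permP[p Ep] : perm_eq [tuple block u i | i < n] [tuple of map snd zt].
    by rewrite /= Ezt.
  exists p; apply: val_inj; apply: (etrans Ep); congr val.
  by apply: eq_from_tnth => i; rewrite !tnth_mktuple tnth_map.
have [y Ey] : exists y : 'S_n, [tuple (tnth zt (p i)).1 | i < n] = [tuple block s (y i) | i < n].
  have /tuple_permP[y Ey] : perm_eq [tuple (tnth zt (p i)).1 | i < n] [tuple block s i | i < n].
    have Pz : perm_eq [tuple (tnth zt (p i)).1 | i < n] [tuple of map fst zt].
      apply/tuple_permP; exists p; congr val.
      by apply: eq_from_tnth => i; rewrite !tnth_mktuple tnth_map.
    apply: perm_trans Pz _; rewrite /= Ezt; apply/allP => a _ /=; rewrite Cz1 eq_sym; apply/eqP.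
    by rewrite -(block_count 1 a Hs); congr (count_mem _ _); apply: eq_map => i; rewrite perm1.
  exists y; apply: val_inj; apply: (etrans Ey); congr val.
  by apply: eq_from_tnth => i; rewrite !tnth_mktuple.
have Pyz : perm_eq (joint_colouring s u y) z.
  rewrite -Ezt; apply/tuple_permP; exists p; congr val.
  apply: eq_from_tnth => i; rewrite !tnth_mktuple [RHS]surjective_pairing; congr (_, _).
    by have := congr1 (fun t : n.-tuple _ => tnth t i) Ey; rewrite !tnth_mktuple.
  by have := congr1 (fun t : n.-tuple _ => tnth t i) Ep; rewrite !tnth_mktuple.
exists y; apply: eq_from_tnth => j; apply/ffunP => i; apply: ord_inj.
rewrite joint_typeE // (seq.permP Pyz) Cz (bigD1 j) //= (bigD1 i) //= eqxx mul1n.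
rewrite !big1 ?addn0 // => [j' Hj|i' Hi].
  rewrite big1 // => i' _; rewrite xpair_eqE; move: Hj; rewrite -val_eqE /= => /negbTE ->.
  by rewrite andbF.
by rewrite xpair_eqE; move: Hi; rewrite -val_eqE /= => /negbTE ->.
Qed.

Lemma cfdot_young_char_marginals s u : sumn s = n -> sumn u = n -> size s = N ->
  ('[young_char n s, young_char n u] = #|[set M | marginals (u := u) s M]|%:R)%R.
Proof.
move=> Hs Hu HN; rewrite (cfdot_young_char_types n_le_B Hs Hu HN); congr ((_)%:R)%R.
apply: eq_card => M; rewrite inE; apply/imsetP/idP => [[y _ ->]|HM].
  exact: joint_type_marginals.
by have [y <-] := marginals_joint_type Hs Hu HN HM; exists y.
Qed.



End Marginals.

(** * Alternating path counts *)

Section AlternatingPaths.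
Variables N B : nat.
Local Notation T := {ffun 'I_N -> 'I_B.+1}.
Implicit Types (b c : T) (nu : seq nat).

Definition weight b : nat := (\sum_i b i)%N.
Definition below c b := [forall i, c i <= b i].
Definition substep r c b := below c b && (weight c + r == weight b).

(** The head of [nu] is the size of the last step, the one ending in [b]. The number is the
    coefficient of x^(b - a) in the product of complete symmetric functions h_nu. *)
Fixpoint paths nu (a : 'I_N -> nat) b : nat :=
  if nu is r :: nu' then (\sum_(c : T | substep r c b) paths nu' a c)%N
  else [forall i, a i == b i].

(** The columns of the matrix are the increments of the path. This links inner products of Young
    characters with coefficients of symmetric functions. *)
Lemma card_marginal_paths nu (a : 'I_N -> nat) b :
  paths nu a b =
  #|[set M : (size nu).-tuple T | [forall j : 'I_(size nu), (\sum_i tnth M j i)%N == nth 0 nu j]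
      && [forall i, (a i + \sum_j tnth M j i)%N == b i]]|.
Proof.
elim: nu b => [|r nu IH] b /=.
  case: (boolP [forall i, _]) => [/forallP Hab|Hab].
    rewrite (@eq_card1 _ [tuple]) // => M; rewrite (tuple0 M) !inE eqxx.
    apply/andP; split; apply/forallP; first by case.
    by move=> i; rewrite big_ord0 addn0 Hab.
  apply/esym/eqP; rewrite cards_eq0; apply/eqP/setP => M; rewrite !inE.
  apply/negbTE; apply: contra Hab => /andP[_ /forallP Hab]; apply/forallP => i.
  by have := Hab i; rewrite big_ord0 addn0.
pose h (p : T * (size nu).-tuple T) := [tuple of p.1 :: p.2].
have hS p j : tnth (h p) (lift ord0 j) = tnth p.2 j by rewrite /h tnthS.
have sumh c M i : (\sum_j tnth (h (c, M)) j i = c i + \sum_j tnth M j i)%N.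
  by rewrite big_ord_recl tnth0; congr (_ + _)%N; apply: eq_bigr => j _; rewrite hS.
(* Complementation in [b] exchanges the first column with the point from which the path reaches [b];
   it is an involution below [b]. *)
pose sb c : T := [ffun i => inord (b i - c i)].
have sbE c i : sb c i = (b i - c i)%N :> nat.
  by rewrite ffunE inordK // ltnS (leq_trans (leq_subr _ _)) // -ltnS.
have sbK c : below c b -> sb (sb c) = c.
  move=> /forallP Hc; apply/ffunP => i; apply: ord_inj; rewrite !sbE.
  by rewrite subKn // Hc.
have wt_sb c : below c b -> (weight (sb c) + weight c)%N = weight b.
  move=> /forallP Hc; rewrite /weight -big_split; apply: eq_bigr => i _.
  by rewrite /= sbE subnK // Hc.
rewrite -sum1_card (reindex h) /=; last first.
  exists (fun M => (thead M, [tuple of behead M])) => [[c M]|M] _ /=.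
    by congr (_, _); apply: val_inj.
  by rewrite [RHS]tuple_eta.
set A := [set M | _].
have -> : (\sum_(p | h p \in A) 1 = \sum_c \sum_(M | h (c, M) \in A) 1)%N.
  by rewrite pair_big_dep; apply: eq_bigl => -[].
rewrite {}/A.
rewrite [RHS](bigID (fun c => below c b)) /= [X in (_ + X)%N]big1 ?addn0; last first.
  move=> c Hc; rewrite big_pred0 // => M; rewrite inE; apply/negbTE/negP => /andP[_ /forallP H].
  case/negP: Hc; apply/forallP => i; rewrite -(eqP (H i)) big_ord_recl tnth0.
  by rewrite addnCA leq_addr.
rewrite [RHS](reindex_onto sb sb) => [|c]; last exact: sbK.
rewrite big_mkcond [RHS]big_mkcond /=; apply: eq_bigr => c _.
have [Hc|Hc] := boolP (below c b); last first.
  rewrite /substep (negbTE Hc) /= ifF //; apply/negbTE/negP => /andP[H1 /eqP H2].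
  case/negP: Hc; apply/forallP => i; rewrite -H2 sbE; exact: leq_subr.
rewrite sbK // eqxx andbT.
have -> : below (sb c) b by apply/forallP => i; rewrite sbE leq_subr.
rewrite IH /substep Hc /=; case: eqP => Hr; last first.
  rewrite big_pred0 // => M; rewrite inE; apply/negbTE/negP => /andP[/forallP/(_ ord0)/eqP H _].
  by apply: Hr; rewrite -(wt_sb c Hc) addnC; congr (_ + _)%N; rewrite -[LHS]H tnth0.
rewrite -sum1_card; apply: eq_bigl => M; rewrite !inE; congr (_ && _).
  apply/forallP/forallP => H j.
    case: (unliftP ord0 j) => [j'|] ->; first by rewrite hS /= H.
    by rewrite tnth0 /=; apply/eqP; have := wt_sb c Hc; rewrite -Hr addnC => /addnI.
  apply/eqP; apply: etrans (eqP (H (lift ord0 j))); apply: eq_bigr => i _.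
  by rewrite (hS (sb c, M) j).
apply: eq_forallb => i; rewrite sumh sbE.
move/forallP: Hc => /(_ i); move: (c i : nat) (b i : nat) => x y.
by move: (bigop _ _ _) => z Hxy; apply/eqP/eqP; lia.
Qed.

End AlternatingPaths.

(** * Antisymmetry and the Pieri rule *)

Section AltPaths.
Variables N B : nat.
Local Notation T := {ffun 'I_N -> 'I_B.+1}.
Implicit Types (b c : T) (nu : seq nat) (w v : 'S_N).
Local Open Scope ring_scope.

(* The coefficient of x^b in a_delta(x) h_nu1(x) h_nu2(x) ..., with delta = (N-1, ..., 1, 0). *)
Definition alt_paths nu b : int :=
  \sum_(w : 'S_N) (-1) ^+ odd_perm w * (paths nu (fun i => rev_ord (w i) : nat) b)%:R.

Lemma alt_paths_cons r nu b :
  alt_paths (r :: nu) b = \sum_(c | substep r c b) alt_paths nu c.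
Proof.
rewrite exchange_big /=; apply: eq_bigr => w _.
by rewrite natr_sum big_distrr.
Qed.

Definition perm_fun (v : 'S_N) b : T := [ffun i => b (v i)].

Lemma perm_funK v : cancel (perm_fun v) (perm_fun v^-1).
Proof. by move=> b; apply/ffunP => i; rewrite !ffunE permKV. Qed.

Lemma perm_funKV v : cancel (perm_fun v^-1) (perm_fun v).
Proof. by move=> b; apply/ffunP => i; rewrite !ffunE permK. Qed.

Lemma perm_fun_tpermK i j : involutive (perm_fun (tperm i j)).
Proof. by move=> b; apply/ffunP => k; rewrite !ffunE tpermK. Qed.

Lemma weight_perm_fun v b : weight (perm_fun v b) = weight b.
Proof.
by rewrite /weight [RHS](reindex_inj (@perm_inj _ v)); apply: eq_bigr => i _; rewrite ffunE.
Qed.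

Lemma below_perm_fun v b c : below (perm_fun v c) (perm_fun v b) = below c b.
Proof.
apply/forallP/forallP => H i; last by rewrite !ffunE.
by have := H (v^-1 i)%g; rewrite !ffunE permKV.
Qed.

(** Steps do not distinguish the coordinates, while the signed sum over starting points w delta is
    antisymmetric. *)
Lemma alt_paths_perm_fun nu v b :
  alt_paths nu (perm_fun v b) = (-1) ^+ odd_perm v * alt_paths nu b.
Proof.
elim: nu b => [|r nu IH] b.
  rewrite /alt_paths (reindex_inj (mulgI v)) big_distrr /=; apply: eq_bigr => w _.
  rewrite odd_permM signr_addb -mulrA; congr (_ * (_ * _%:R)).
  congr (nat_of_bool _); apply/forallP/forallP => H i; last by rewrite permM !ffunE.
  by have := H (v^-1 i)%g; rewrite permM !ffunE permKV.
rewrite !alt_paths_cons (reindex (perm_fun v)) /=; last first.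
  by exists (perm_fun v^-1) => c _; rewrite ?perm_funK ?perm_funKV.
rewrite big_distrr /=; apply: eq_big => [c|c _]; last exact: IH.
by rewrite /substep below_perm_fun !weight_perm_fun.
Qed.

Lemma alt_paths_rep nu b i j : i != j -> b i = b j -> alt_paths nu b = 0.
Proof.
move=> ij Hb; have: perm_fun (tperm i j) b = b.
  by apply/ffunP => k; rewrite ffunE; case: tpermP => // ->.
move/(congr1 (alt_paths nu)); rewrite alt_paths_perm_fun odd_tperm ij mulN1r => /eqP.
by rewrite eq_sym -addr_eq0 -mulr2n mulrn_eq0 => /eqP.
Qed.

Definition decreasing b := [forall i : 'I_N, forall j : 'I_N, (i < j)%N ==> (b j < b i)%N].
(** After subtraction of delta this reads la_(i+1) <= mu_i; together with [below] it says that the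
    difference is a horizontal strip. *)
Definition interlace c b :=
  [forall i : 'I_N, forall j : 'I_N, (j == i.+1 :> nat) ==> (b j < c i)%N].

Lemma decreasingP b : reflect (forall i j : 'I_N, (i < j)%N -> (b j < b i)%N) (decreasing b).
Proof.
apply: (iffP forallP) => H i; last by apply/forallP => j; apply/implyP; exact: H.
by move=> j; apply/implyP/(forallP (H i)).
Qed.

Lemma interlaceP c b :
  reflect (forall i j : 'I_N, j = i.+1 :> nat -> (b j < c i)%N) (interlace c b).
Proof.
apply: (iffP forallP) => H i.
  by move=> j /eqP; apply/implyP/(forallP (H i)).
by apply/forallP => j; apply/implyP => /eqP; exact: H.
Qed.

Definition bad_at b c k :=
  [exists i : 'I_N, exists j : 'I_N, [&& i == k :> nat, j == k.+1 :> nat & (c i <= b j)%N]].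

Lemma bad_atP b c k :
  reflect (exists i j : 'I_N, [/\ i = k :> nat, j = k.+1 :> nat & (c i <= b j)%N]) (bad_at b c k).
Proof.
apply: (iffP existsP) => [[i /existsP[j /and3P[/eqP ? /eqP ? ?]]]|[i [j [H1 H2 H3]]]].
  by exists i, j.
by exists i; apply/existsP; exists j; rewrite H1 H2 H3 !eqxx.
Qed.

Definition first_bad b c k := bad_at b c k && all (fun k' => ~~ bad_at b c k') (iota 0 k).

(** At a violation both c_i and c_j are at most b_j < b_i, so the exchange stays below [b] and keeps
    the violation. Badness at an earlier index involves only the entry of [c] there, which does not
    change. *)
Lemma first_bad_swap b c (i j : 'I_N) : decreasing b -> j = i.+1 :> nat -> below c b ->
  first_bad b c i -> first_bad b (perm_fun (tperm i j) c) i /\ below (perm_fun (tperm i j) c) b.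
Proof.
move=> /decreasingP Hb Hj /forallP Hc /andP[/bad_atP[i' [j' [Ei Ej Hbad]]] Hall].
have {Ei} Ei : i' = i by apply: val_inj.
have {Ej} Ej : j' = j by apply: val_inj; rewrite /= Ej Hj.
subst i' j'.
have ltij : (i < j)%N by rewrite Hj.
split; last first.
  apply/forallP => k; rewrite ffunE; case: tpermP => [->|->|_ _]; last exact: Hc.
    by apply: leq_trans (Hc j) _; apply: ltnW; apply: Hb.
  exact: Hbad.
apply/andP; split; first by apply/bad_atP; exists i, j; rewrite ffunE tpermL Hc.
apply/allP => k Hk; have /= := allP Hall k Hk; apply: contra.
move: Hk; rewrite mem_iota add0n => /andP[_ Hk] /bad_atP[i' [j' [E1 E2]]].
rewrite ffunE tpermD => [H| |]; first by apply/bad_atP; exists i', j'.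
  by rewrite -val_eqE /= E1 neq_ltn Hk orbT.
by rewrite -val_eqE /= E1 Hj; lia.
Qed.

(* Exchanging the two coordinates at the first violation of interlacing is a
   sign-reversing involution. *)
Lemma alt_paths_pieri r nu b : decreasing b ->
  alt_paths (r :: nu) b = \sum_(c | substep r c b && interlace c b) alt_paths nu c.
Proof.
move=> Hb; rewrite alt_paths_cons (bigID (fun c => interlace c b)) /=.
rewrite [X in _ + X](_ : _ = 0) ?addr0 //.
have Ebad c : ~~ interlace c b = has (bad_at b c) (iota 0 N).
  apply/idP/hasP => [|[k _ /bad_atP[i [j [E1 E2 Hc]]]]].
    rewrite negb_forall => /existsP[i]; rewrite negb_forall => /existsP[j].
    rewrite negb_imply -leqNgt => /andP[/eqP E H]; exists (i : nat); first by rewrite mem_iota /=.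
    by apply/bad_atP; exists i, j.
  by apply/negP => /interlaceP/(_ i j); rewrite ltnNge Hc E1 E2 => /(_ erefl).
pose p c : 'I_N.+1 := inord (find (bad_at b c) (iota 0 N)).
rewrite (partition_big p xpredT) //= big1 // => k _.
have Hp c : (~~ interlace c b && (p c == k)) = (k < N)%N && first_bad b c k.
  rewrite Ebad /first_bad -val_eqE /= inordK; last first.
    by rewrite ltnS -[X in (_ <= X)%N](size_iota 0 N) find_size.
  apply/andP/andP => [[Hh /eqP Hf]|[HkN /andP[Hk /allP Ha]]].
    have HkN : (k < N)%N by rewrite -Hf -[X in (_ < X)%N](size_iota 0 N) -has_find.
    split=> //; apply/andP; split.
      by have := nth_find 0 Hh; rewrite Hf nth_iota.
    apply/allP => k'; rewrite mem_iota add0n => /andP[_ Hk'].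
    have := @before_find _ 0%N (bad_at b c) (iota 0 N) k'; rewrite Hf => /(_ Hk').
    by rewrite nth_iota ?(ltn_trans Hk' HkN) // => ->.
  have Hh : has (bad_at b c) (iota 0 N) by apply/hasP; exists (k : nat); rewrite ?mem_iota.
  split=> //; rewrite eqn_leq; apply/andP; split.
    rewrite leqNgt; apply/negP => /(before_find 0%N); rewrite nth_iota // add0n.
    by rewrite Hk.
  rewrite leqNgt; apply/negP => Hlt.
  have := Ha (find (bad_at b c) (iota 0 N)); rewrite mem_iota Hlt => /(_ isT)/negP; apply.
  by have := nth_find 0%N Hh; rewrite nth_iota // (ltn_trans Hlt).
under eq_bigl => c do rewrite -andbA Hp.
have [kN|] := ltnP k N; last by move=> _; rewrite big_pred0 // => c; rewrite andbF.
rewrite /=; have [k1N|k1N] := ltnP k.+1 N; last first.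
  rewrite big_pred0 // => c; apply/negbTE/negP => /andP[_ /andP[/bad_atP[i [j [_ E _]]] _]].
  by have := ltn_ord j; rewrite E ltnNge k1N.
pose i := Ordinal kN; pose j := Ordinal k1N.
set S := \sum_(_ | _) _; suff : S = - S.
  by move/eqP; rewrite -addr_eq0 -mulr2n mulrn_eq0 => /eqP.
rewrite {1}/S (reindex (perm_fun (tperm i j))) /=; last first.
  by exists (perm_fun (tperm i j)) => c _; rewrite perm_fun_tpermK.
rewrite -sumrN; apply: eq_big => [c|c _]; last first.
  by rewrite alt_paths_perm_fun odd_tperm -val_eqE /= neq_ltn ltnSn mulN1r.
have sw c' : substep r c' b && first_bad b c' k ->
   substep r (perm_fun (tperm i j) c') b && first_bad b (perm_fun (tperm i j) c') k.
  move=> /andP[/andP[Hc Hw] Hf]; have [//|H1 H2] := first_bad_swap (i := i) (j := j) Hb _ Hc Hf.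
  by rewrite /substep H2 H1 weight_perm_fun Hw.
by apply/idP/idP => /sw //; rewrite perm_fun_tpermK.
Qed.

End AltPaths.

(** * Triangularity with respect to dominance *)

Section Dominance.
Variables N B : nat.
Local Notation T := {ffun 'I_N -> 'I_B.+1}.
Implicit Types (b c : T) (nu : seq nat).

Definition value_at b k : nat := oapp (fun i => b i : nat) 0 (insub k).

Lemma value_atE b (i : 'I_N) : value_at b i = b i.
Proof. by rewrite /value_at valK. Qed.

Lemma weight_value_at b : weight b = \sum_(0 <= i < N) value_at b i.
Proof. by rewrite big_mkord; apply: eq_bigr => i _; rewrite value_atE. Qed.

Lemma decreasing_at b : decreasing b ->
  (forall i j, i < j -> j < N -> value_at b j < value_at b i).
Proof.
move=> /decreasingP H i j ij jN; have iN := ltn_trans ij jN.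
by rewrite (value_atE b (Ordinal iN)) (value_atE b (Ordinal jN)) H.
Qed.

Lemma interlace_at b c : interlace c b -> forall i, i.+1 < N -> value_at b i.+1 < value_at c i.
Proof.
move=> /interlaceP H i iN; have iN' := ltnW iN.
by rewrite (value_atE b (Ordinal iN)) (value_atE c (Ordinal iN')) H.
Qed.

Lemma interlace_decreasing b c : decreasing b -> below c b -> interlace c b -> decreasing c.
Proof.
move=> /decreasing_at Hb /forallP Hc /interlace_at Hi; apply/decreasingP => i j ij.
have H1 := Hi i (leq_ltn_trans ij (ltn_ord j)).
rewrite -(value_atE c i); apply: leq_ltn_trans H1; apply: leq_trans (Hc j) _.
rewrite -(value_atE b j); move: ij; rewrite leq_eqVlt => /orP[/eqP -> //|ij].
exact/ltnW/Hb.
Qed.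

Lemma decreasing_ge b k : decreasing b -> k < N -> N - k.+1 <= value_at b k.
Proof.
move=> Hb; move E: (N - k.+1) => d; elim: d k E => [//|d IH] k E kN.
have k1N : k.+1 < N by lia.
have := IH k.+1 _ k1N; have := decreasing_at Hb (ltnSn k) k1N; lia.
Qed.

(** The coefficient is a Kostka number, and this is its vanishing outside the dominance order: one
    part is peeled off by the Pieri rule. *)
Lemma alt_paths_dominance nu b k : decreasing b -> alt_paths nu b != 0%R -> k <= N ->
  \sum_(0 <= j < k) nth 0 nu j + \sum_(0 <= i < k) (N - i.+1) <= \sum_(0 <= i < k) value_at b i.
Proof.
elim: nu b k => [|r nu IH] b k Hb Hw kN.
  rewrite big1_seq ?add0n => [|i _]; last by rewrite nth_nil.
  rewrite !big_nat; apply: leq_sum => i /andP[_ ik].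
  by apply: decreasing_ge => //; apply: leq_trans kN.
case: k kN => [|k] kN; first by rewrite !big_geq.
have [c /andP[/andP[Hc /eqP Hwt] Hi] Hwc] :
    exists2 c, substep r c b && interlace c b & alt_paths nu c != 0%R.
  apply/exists_inP; apply: contraR Hw; rewrite negb_exists_in => /forall_inP H.
  by rewrite alt_paths_pieri // big1 // => c /H; rewrite negbK => /eqP.
have := IH c k (interlace_decreasing Hb Hc Hi) Hwc (ltnW kN).
move: Hwt; rewrite !weight_value_at (big_cat_nat (n := k) _ (ltnW kN)) //=.
rewrite [X in _ = X](big_cat_nat (n := k.+1) _ kN) //=.
rewrite [\sum_(0 <= j < k.+1) nth _ _ _]big_nat_recl //= [\sum_(0 <= j < k.+1) (N - _)]big_nat_recr //=.
(* As the weights of [b] and [c] are known, it is enough to compare tails, where interlacing gives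
   b_(i+1) + 1 <= c_i. *)
suff : \sum_(k.+1 <= i < N) value_at b i + (N - k.+1) <= \sum_(k <= i < N) value_at c i by lia.
have auxr (F : nat -> nat) : \sum_(k <= i < N) F i = \sum_(k <= i < N.-1) F i + F N.-1.
  by move: kN; case: (N) => // N' kN; rewrite big_nat_recr.
have auxl (F : nat -> nat) : \sum_(k.+1 <= i < N) F i = \sum_(k <= i < N.-1) F i.+1.
  by move: kN; case: (N) => // N' kN; rewrite big_add1.
rewrite auxr auxl.
apply: leq_trans (leq_addr _ _).
have -> : N - k.+1 = \sum_(k <= i < N.-1) 1 by rewrite sum_nat_const_nat muln1; lia.
rewrite -big_split /= !big_nat; apply: leq_sum => i /andP[_ Hi']; rewrite addn1.
by apply: interlace_at => //; lia.
Qed.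

(** Diagonal Kostka numbers are 1: interlacing bounds every admissible [d] from below by the tail of
    the composition plus delta, and the weight leaves no room for a larger entry. *)
Lemma alt_paths_diag nu b : decreasing b -> size nu <= N ->
  (forall i : 'I_N, b i = nth 0 nu i + (N - i.+1) :> nat) -> alt_paths nu b = 1%R.
Proof.
elim: nu b => [|r nu IH] b Hb Hs HE.
  rewrite /alt_paths (bigD1 1%g) //= big1 ?addr0 => [|w Hw].
    rewrite odd_perm1 mul1r; set P := [forall i, _]; suff -> : P by [].
    by apply/forallP => i; rewrite perm1 HE nth_nil.
  rewrite /=; case: (boolP [forall i, _]) => [/forallP H|_]; last by rewrite mulr0.
  case/eqP: Hw; apply/permP => i.
  rewrite perm1; apply: ord_inj; have := H i; rewrite HE nth_nil /=.
  by have := ltn_ord i; have := ltn_ord (w i); lia.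
have Hmono i : i.+1 < N -> nth 0 nu i <= nth 0 (r :: nu) i.
  move=> iN; have := decreasing_at Hb (ltnSn i) iN; have iN' := ltnW iN.
  by rewrite (value_atE b (Ordinal iN)) (value_atE b (Ordinal iN')) !HE /=; lia.
have Hlast : nth 0 nu N.-1 = 0 by rewrite nth_default //; move: Hs => /=; lia.
pose c : T := [ffun i : 'I_N => inord (nth 0 nu i + (N - i.+1))].
have cE i : c i = nth 0 nu i + (N - i.+1) :> nat.
  rewrite ffunE inordK // ltnS; apply: leq_trans (_ : b i <= _); last by rewrite -ltnS.
  rewrite HE leq_add2r; have [/Hmono //|Hi] := ltnP i.+1 N.
  by rewrite (_ : (i : nat) = N.-1) ?Hlast //; have := ltn_ord i; lia.
have Hcb : below c b.
  apply/forallP => i; rewrite cE HE leq_add2r; have [/Hmono //|Hi] := ltnP i.+1 N.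
  by rewrite (_ : (i : nat) = N.-1) ?Hlast //; have := ltn_ord i; lia.
have Hci : interlace c b.
  by apply/interlaceP => i j E; rewrite cE HE E /=; have := ltn_ord j; lia.
have wtc : weight c + r = weight b.
  rewrite /weight; under eq_bigr do rewrite cE; under [RHS]eq_bigr do rewrite HE.
  rewrite !big_split /= addnAC; congr (_ + _).
  move: Hs Hlast {Hmono Hci Hcb}; rewrite /= -(big_mkord xpredT) -(big_mkord xpredT (nth 0 (r :: nu))).
  by case: (N) => // N' _ Hlast; rewrite big_nat_recr //= Hlast addn0 [RHS]big_nat_recl //= addnC.
rewrite alt_paths_pieri // (bigD1 c) /=; last by rewrite /substep Hcb wtc eqxx Hci.
rewrite big_pred0 ?addr0 => [|d].
  by apply: IH => //; [exact: interlace_decreasing Hb Hcb Hci | exact: ltnW].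
apply/negbTE/negP => /andP[/andP[/andP[Hd /eqP Hwd] Hdi] /negP]; apply.
have Hcd i : c i <= d i.
  rewrite cE; have [iN|Hi] := ltnP i.+1 N.
    by have := interlace_at Hdi iN; rewrite (value_atE b (Ordinal iN)) value_atE HE /=; lia.
  have -> : (i : nat) = N.-1 by have := ltn_ord i; lia.
  by rewrite Hlast; have := ltn_ord i; lia.
have Hw : weight d = weight c by apply/eqP; rewrite -(eqn_add2r r) Hwd wtc.
apply/eqP/ffunP => i; apply: ord_inj; apply/eqP; rewrite eq_sym.
move/eqP: Hw; rewrite eq_sym (leqif_sum (fun i _ => leqif_eq (Hcd i))).
by move/forall_inP => ->.
Qed.

End Dominance.

(** * The character labelled by a partition *)

Section ConjugatePartition.
Implicit Types (la : seq nat).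

Lemma conj_partP la i c : sorted geq la -> (i < nth 0 (conj_part la) c) = (c < nth 0 la i).
Proof.
move=> Hs; have [lt_c|le_c] := ltnP c (head 0 la); last first.
  rewrite nth_default ?size_mkseq // ltn0; apply/esym/negbTE; rewrite -leqNgt.
  apply: leq_trans le_c; have [lt_i|le_i] := ltnP i (size la); last by rewrite nth_default.
  rewrite -nth0; apply: (sorted_leq_nth (leT := geq)) => //=; rewrite ?inE //.
  - by move=> a b d /= H1 H2; apply: leq_trans H1.
  - exact: leqnn.
  - exact: leq_ltn_trans lt_i.
rewrite nth_mkseq //; elim: la Hs i {lt_c} => [|a la IH] /= Hs i; first by rewrite nth_nil.
have Hs' := path_sorted Hs.
have Hmin : all (geq a) la.
  by apply: order_path_min Hs => x y z /= H1 H2; apply: leq_trans H1.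
have H0 : a <= c -> count (fun x => c < x) la = 0.
  move=> le_ac; apply/eqP; rewrite -leqn0 leqNgt -has_count -all_predC.
  by apply: sub_all Hmin => b /= Hb; rewrite -leqNgt; apply: leq_trans le_ac.
case: i => [|i] /=; case: (ltnP c a) => //= le_ac; rewrite ?add1n.
- by rewrite H0.
- by rewrite ltnS IH.
- by rewrite -(IH Hs') H0.
Qed.

Lemma sorted_geq_nth la i j : sorted geq la -> i <= j -> nth 0 la j <= nth 0 la i.
Proof.
move=> Hs ij; rewrite leqNgt -conj_partP //; apply/negP => H.
by have := leq_ltn_trans ij H; rewrite conj_partP // ltnn.
Qed.

Lemma sum_leq_indicator m k : k <= m -> \sum_(i < m) (i < k) = k.
Proof.
move=> km; rewrite -[RHS]card_ord -sum1_card -(big_mkord xpredT (fun=> 1)) (big_nat_widen _ _ _ _ _ km).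
by rewrite -(big_mkord xpredT (fun i => nat_of_bool (i < k))) [RHS]big_mkcond; apply: eq_bigr.
Qed.

Lemma nth_le_head la i : sorted geq la -> nth 0 la i <= head 0 la.
Proof.
move=> Hs; have := conj_partP i (head 0 la) Hs; rewrite nth_default ?size_mkseq // ltn0.
by rewrite ltnNge => /esym/negbFE.
Qed.

Lemma nth_conj_le_size la c : sorted geq la -> nth 0 (conj_part la) c <= size la.
Proof.
move=> Hs; have := conj_partP (size la) c Hs; rewrite [nth 0 la _]nth_default // ltn0.
by rewrite ltnNge => /negbFE.
Qed.

Lemma sumn_nth (s : seq nat) : sumn s = \sum_(i < size s) nth 0 s i.
Proof. by rewrite sumnE (big_nth 0) big_mkord. Qed.

Lemma sumn_conj_part la : sorted geq la -> sumn (conj_part la) = sumn la.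
Proof.
move=> Hs; rewrite !sumn_nth size_mkseq.
under eq_bigr => c _ do rewrite -(sum_leq_indicator (nth_conj_le_size c Hs)).
under [RHS]eq_bigr => i _ do rewrite -(sum_leq_indicator (nth_le_head i Hs)).
by rewrite exchange_big; apply: eq_bigr => i _; apply: eq_bigr => c _; rewrite conj_partP.
Qed.

End ConjugatePartition.

(** * Common constituents of Young characters and signed Young characters *)

Section Labels.
Variable n : nat.
Implicit Types (la s u : seq nat).
Local Notation block s i := (reshape_index s (nat_of_ord i)).

Lemma young_char_char s : young_char n s \is a character.
Proof. by rewrite cfInd_char ?rpred1. Qed.

Fact sign_repr_subproof : mx_repr [set: 'S_n] (fun g : 'S_n => ((-1) ^+ odd_perm g)%:M : 'M[algC]_1)%R.
Proof.
split=> [|g h _ _]; first by rewrite odd_perm1.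
by rewrite odd_permM signr_addb scalar_mxM.
Qed.

Lemma sign_char_char : sign_char n \is a character.
Proof.
have -> : sign_char n = cfRepr (MxRepresentation sign_repr_subproof).
  by apply/cfun_inP => g Hg; rewrite cfunE Hg sign_charE mulr1n mxtrace_scalar mulr1n.
exact: cfRepr_char.
Qed.

Lemma signed_young_char_char s : signed_young_char n s \is a character.
Proof. by rewrite cfInd_char ?cfRes_char ?sign_char_char. Qed.

Lemma cfdot_neq0_constt (phi psi : 'CF([set: 'S_n])) : ('[phi, psi] != 0)%R ->
  exists2 i, i \in irr_constt phi & i \in irr_constt psi.
Proof.
rewrite cfdot_sum_irr => H; have [i Hi] : exists i, ('[phi, 'chi_i] * ('[psi, 'chi_i])^* != 0)%R.
  apply/existsP; apply: contraR H; rewrite negb_exists => /forallP H.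
  by rewrite big1 // => i _; have := H i; rewrite negbK => /eqP.
by move: Hi; rewrite mulf_eq0 conjC_eq0 negb_or -!irr_consttE => /andP[H1 H2]; exists i.
Qed.

Lemma cfdot_eq0_constt (phi psi : 'CF([set: 'S_n])) i :
  phi \is a character -> psi \is a character -> ('[phi, psi] = 0)%R ->
  i \in irr_constt psi -> ('[phi, 'chi_i] = 0)%R.
Proof.
move=> Hphi Hpsi H0 Hi; apply/eqP; apply: contraT; rewrite -irr_consttE => Hi'.
by have /eqP := constt_ortho_char Hphi Hpsi Hi' Hi H0; rewrite cfnorm_irr oner_eq0.
Qed.

(** Points in one block of [u] lie in distinct blocks of [s], so at most min(k, u_b) of them fall
    into the first [k] blocks of [s]. Summed over all b, these minima give the first [k] parts of
    [la]. *)
Lemma gale_ryser s la k : sorted geq la -> sumn la = n -> sumn s = n ->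
  ('[young_char n s, signed_young_char n (conj_part la)] != 0)%R ->
  \sum_(0 <= j < k) nth 0 s j <= \sum_(0 <= j < k) nth 0 la j.
Proof.
move=> Hla Hn Hs /cfdot_signed_neq0P[y inj].
set u := conj_part la in inj.
have Hu : sumn u = n by rewrite sumn_conj_part.
have -> : \sum_(0 <= j < k) nth 0 s j = #|[pred x : 'I_n | block s (y x) < k]|.
  rewrite big_mkord -sum1_card.
  rewrite (eq_bigr (fun j : 'I_k => \sum_(x : 'I_n | block s (y x) == j) 1)) => [|j _]; last first.
    by rewrite -(block_card y j Hs) -sum1_card.
  rewrite (exchange_big_dep (fun x => block s (y x) < k)) /= => [|j x _]; last first.
    by move/eqP=> ->.
  by apply: eq_bigr => x Hx; rewrite (big_pred1 (Ordinal Hx)).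
have -> : \sum_(0 <= j < k) nth 0 la j = \sum_(b < head 0 la) minn k (nth 0 u b).
  rewrite big_mkord.
  under eq_bigr => i _ do rewrite -(sum_leq_indicator (nth_le_head i Hla)).
  rewrite exchange_big; apply: eq_bigr => b _.
  under eq_bigr => i _ do rewrite -conj_partP //.
  rewrite /minn; case: ltnP => H; last exact: sum_leq_indicator.
  by rewrite -[RHS]card_ord -sum1_card; apply: eq_bigr => i _; rewrite (ltn_trans _ H).
have Hd (x : 'I_n) : block u x < head 0 la.
  by have := @reshape_indexP u x; rewrite size_mkseq; apply; rewrite Hu.
rewrite -sum1_card (partition_big (fun x => Ordinal (Hd x)) xpredT) //=.
apply: leq_sum => b _; rewrite sum1_card leq_min; apply/andP; split.
  rewrite -[k in _ <= k]card_ord.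
  (* The option type makes the map total; on the points in question it is injective and avoids
     [None], hence there are at most [k] of them. *)
  pose h (x : 'I_n) : option 'I_k := insub (block s (y x)).
  rewrite -(card_in_image (f := h)) => [|x x']; last first.
    rewrite !unfold_in -!val_eqE /= => /andP[Hx /eqP Hb] /andP[Hx' /eqP Hb'].
    rewrite /h !insubT => -[E]; apply: inj; congr (_, _) => //; exact: etrans Hb (esym Hb').
  apply: leq_trans (_ : #|[pred o : option 'I_k | o != None]| <= _); last first.
    by have := cardC1 (None : option 'I_k); rewrite card_option /= => ->.
  apply/subset_leq_card/subsetP => o /imageP[x]; rewrite unfold_in => /andP[Hx _] ->.
  by rewrite /h insubT.
rewrite -(block_card 1 b Hu); apply/subset_leq_card/subsetP => x; rewrite unfold_in -val_eqE /=.
by move=> /andP[_ Hx]; rewrite unfold_in /= perm1.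
Qed.

(** The 0-1 matrix of the Young diagram has row sums [la] and column sums [conj_part la]. A [y]
    realising it separates points because no entry exceeds 1. Hence a label exists. *)
Lemma young_signed_young_neq0 la : sorted geq la -> sumn la = n ->
  ('[young_char n la, signed_young_char n (conj_part la)] != 0)%R.
Proof.
move=> Hla Hn; set u := conj_part la.
have Hu : sumn u = n by rewrite sumn_conj_part.
have su : size u = head 0 la by rewrite size_mkseq.
(* The bound n + 1 on the entries leaves room for the value 1 even if n = 0. *)
pose M := [tuple [ffun i : 'I_(size la) => inord (j < nth 0 la i)] | j < size u] : (size u).-tuple {ffun 'I_(size la) -> 'I_n.+2}.
have ME j i : tnth M j i = (j < nth 0 la i) :> nat.
  by rewrite tnth_mktuple ffunE inordK // ltnS; case: (_ < _).
have HM : marginals la M.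
  apply/andP; split; apply/forallP => k; under eq_bigr do rewrite ME.
    under eq_bigr do rewrite -conj_partP //.
    by rewrite sum_leq_indicator // nth_conj_le_size.
  by rewrite sum_leq_indicator // su nth_le_head.
have [y Hy] := marginals_joint_type (leqnSn n) Hn Hu erefl HM.
apply/cfdot_signed_neq0P; exists y => x x' [Es Eu].
have Hux : block u x < size u by rewrite reshape_indexP ?Hu.
have Hsx : block la (y x) < size la by rewrite reshape_indexP ?Hn.
have := ME (Ordinal Hux) (Ordinal Hsx); rewrite -Hy joint_typeE // count_joint_colouring /=.
move=> E; apply/eqP; apply: contraT => ne.
suff : 1 < 1 by []. apply: leq_trans (_ : nat_of_bool (block u x < nth 0 la (block la (y x))) <= 1); last by case: (_ < _).
rewrite -E (cardD1 x) (cardD1 x') !inE /= Es Eu !eqxx eq_sym ne.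
by [].
Qed.

End Labels.

(** * The determinantal character and its degree *)

Section Frobenius.
Variables (n : nat) (la : seq nat).
Hypotheses (la_sorted : sorted geq la) (la_sum : sumn la = n).
Local Notation N := (size la).
Local Notation B := (n + N).
Local Notation T := {ffun 'I_N -> 'I_B.+1}.
Implicit Types w : 'S_N.

(* No value of [bead_fun] exceeds the bound n + N of its codomain, so [inord] never truncates. *)
Definition bead_fun : T := [ffun i : 'I_N => inord (nth 0 la i + (N - i.+1))].
Local Notation b := bead_fun.

Lemma nth_le_sumn (s : seq nat) i : nth 0 s i <= sumn s.
Proof.
elim: s i => [|a s IH] [|i] //=; first exact: leq_addr.
exact: leq_trans (IH i) (leq_addl _ _).
Qed.

Lemma bead_funE i : b i = nth 0 la i + (N - i.+1) :> nat.
Proof.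
rewrite ffunE inordK // ltnS leq_add ?leq_subr //.
by rewrite -la_sum nth_le_sumn.
Qed.

Lemma bead_fun_decreasing : decreasing b.
Proof.
apply/decreasingP => i j ij; rewrite !bead_funE.
by have := ltn_ord j; have := sorted_geq_nth la_sorted (ltnW ij); lia.
Qed.

Definition shifted w : seq nat := [seq b i - rev_ord (w i) | i : 'I_N].
Definition valid w := [forall i, rev_ord (w i) <= b i].

Lemma size_shifted w : size (shifted w) = N.
Proof. by rewrite size_map size_enum_ord. Qed.

Lemma nth_shifted w (i : 'I_N) : nth 0 (shifted w) i = b i - rev_ord (w i).
Proof. by rewrite (nth_map i) ?size_enum_ord // nth_ord_enum. Qed.

Lemma sum_rev_ord_perm w : \sum_i rev_ord (w i) = \sum_(i < N) (N - i.+1).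
Proof. by rewrite [RHS](reindex_inj (@perm_inj _ w)). Qed.

Lemma sumn_shifted w : valid w -> sumn (shifted w) = n.
Proof.
move=> /forallP Hw; apply/eqP; rewrite -(eqn_add2r (\sum_(i < N) (N - i.+1))).
rewrite -{1}(sum_rev_ord_perm w) sumnE big_map big_enum /= -big_split /=.
under eq_bigr => i _ do rewrite subnK ?Hw //.
under eq_bigr => i _ do rewrite bead_funE.
by rewrite big_split /= -sumn_nth la_sum eqn_add2l; apply/eqP; apply: eq_bigl => i; rewrite inE.
Qed.

Lemma shifted1 : shifted 1 = la.
Proof.
apply: (@eq_from_nth _ 0); rewrite size_shifted // => i Hi.
by rewrite (nth_shifted _ (Ordinal Hi)) bead_funE perm1 /= addnK.
Qed.

Lemma valid1 : valid 1.
Proof. by apply/forallP => i; rewrite bead_funE perm1 /= leq_addl. Qed.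

(** The first index not fixed by [w] is sent to a larger one. There less is subtracted from la +
    delta, and before it the parts are those of [la]. *)
Lemma shifted_dominates w : w != 1%g -> valid w -> exists2 k, k <= N &
  \sum_(0 <= j < k) nth 0 la j < \sum_(0 <= j < k) nth 0 (shifted w) j.
Proof.
move=> w1 /forallP Hw.
have [i0 Hi0 Hmin] : exists2 i0 : 'I_N, w i0 != i0 & forall i : 'I_N, i < i0 -> w i = i.
  have [i Hi] : exists i, w i != i.
    apply/existsP; apply: contraR w1; rewrite negb_exists => /forallP H.
    by apply/eqP/permP => i; rewrite perm1; apply/eqP; have := H i; rewrite negbK.
  case: (@arg_minnP _ i (fun i => w i != i) (fun i : 'I_N => i : nat) Hi) => i0 Hi0 Hm; exists i0 => // j Hj.
  by apply/eqP; apply: contraLR Hj => /Hm; rewrite -leqNgt.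
have Hgt : i0 < w i0.
  have Hne : (w i0 : nat) != i0 by apply: contra Hi0 => /eqP/ord_inj/eqP.
  rewrite ltn_neqAle eq_sym Hne leqNgt /=.
  by apply/negP => H; have := Hmin _ H => /perm_inj E; rewrite E ltnn in H.
exists i0.+1 => //.
rewrite !big_nat_recr //= -addnS leq_add //.
  rewrite !big_nat; apply: leq_sum => i /andP[_ Hi].
  have iN := ltn_trans Hi (ltn_ord i0).
  by rewrite (nth_shifted w (Ordinal iN)) Hmin // bead_funE /= addnK.
rewrite nth_shifted bead_funE /=; have := ltn_ord (w i0); lia.
Qed.

Local Open Scope ring_scope.

(* The Jacobi-Trudi determinant; a term with a negative part, on which the subtraction in
   [shifted] would truncate, contributes 0. *)
Definition frobenius : 'CF([set: 'S_n]) :=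
  \sum_w (-1) ^+ odd_perm w *: (if valid w then young_char n (shifted w) else 0).

(** Matrices with row sums [shifted w] and column sums [nu] are the paths from w delta to la +
    delta; an invalid [w] admits none, in accordance with its value 0. *)
Lemma cfdot_frobenius nu : sumn nu = n ->
  '[frobenius, young_char n nu] = (alt_paths nu b)%:~R.
Proof.
move=> Hnu; rewrite cfdot_suml rmorph_sum /=; apply: eq_bigr => w _.
rewrite cfdotZl rmorphM /= rmorph_sign; congr (_ * _).
rewrite rmorph_nat card_marginal_paths.
have [Hw|Hw] := boolP (valid w); last first.
  rewrite cfdot0l (@eq_card0 _ [set _ | _]) // => M; rewrite inE; apply/negbTE.
  apply: contra Hw => /andP[_ /forallP H]; apply/forallP => i.
  by rewrite -(eqP (H i)) leq_addr.
rewrite (cfdot_young_char_marginals (leq_addr N n) (sumn_shifted Hw) Hnu (size_shifted w)).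
congr (_%:R); apply: eq_card => M; rewrite !inE /marginals; congr (_ && _).
apply: eq_forallb => i; rewrite nth_shifted.
move/forallP/(_ i): Hw => Hi; apply/eqP/eqP => [->|<-]; first by rewrite subnKC.
by rewrite addKn.
Qed.

Lemma frobenius_vchar : frobenius \in ('Z[irr [set: 'S_n]])%g.
Proof.
apply: rpred_sum => w _; rewrite rpredZsign; case: ifP => _; last exact: rpred0.
exact/char_vchar/young_char_char.
Qed.

(** Expanding one factor leaves coefficients with nu = [shifted w]. For w other than 1 a partial sum
    of nu is too large for [alt_paths_dominance]; w = 1 contributes 1 by [alt_paths_diag]. *)
Lemma frobenius_norm : '[frobenius] = 1.
Proof.
rewrite {2}/frobenius cfdot_sumr (bigD1 1%g) //= big1 => [|w Hw].
  rewrite valid1 odd_perm1 scale1r addr0 cfdot_frobenius ?shifted1 //.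
  by rewrite alt_paths_diag ?bead_fun_decreasing // => i; rewrite bead_funE.
rewrite cfdotZr; case: ifP => Hv; last by rewrite cfdot0r mulr0.
rewrite cfdot_frobenius ?sumn_shifted //; case: (eqVneq (alt_paths (shifted w) b) 0) => [->|H].
  by rewrite mulr0.
have [k kN Hk] := shifted_dominates Hw Hv.
have := alt_paths_dominance bead_fun_decreasing H kN.
suff -> : (\sum_(0 <= i < k) value_at b i = \sum_(0 <= i < k) nth 0 la i + \sum_(0 <= i < k) (N - i.+1))%N.
  by rewrite leq_add2r leqNgt Hk.
rewrite -big_split /= !big_nat; apply: eq_bigr => i /andP[_ ik].
by have iN := leq_trans ik kN; rewrite (value_atE _ (Ordinal iN)) bead_funE.
Qed.

(** Only w = 1 survives: the Young character of any other [shifted w] is orthogonal to the signed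
    Young character that contains the labelled constituent, by [gale_ryser] and
    [shifted_dominates]. *)
Lemma frobenius_label i : is_label la i -> '[frobenius, 'chi_i] != 0.
Proof.
move=> /andP[Hi1 Hi2]; rewrite cfdot_suml (bigD1 1%g) //= big1 ?addr0.
  by rewrite valid1 odd_perm1 scale1r shifted1 -irr_consttE.
move=> w Hw; rewrite cfdotZl; case: ifP => Hv; last by rewrite cfdot0l mulr0.
rewrite (cfdot_eq0_constt (young_char_char _ _) (signed_young_char_char _ (conj_part la))) ?mulr0 //.
apply/eqP; apply: contraT => /(gale_ryser _ la_sorted la_sum (sumn_shifted Hv)) Hgr.
by have [k _] := shifted_dominates Hw Hv; rewrite ltnNge Hgr.
Qed.

(** The Young subgroup of (1, ..., 1) is trivial, so the inner product with its Young character is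
    evaluation at 1. *)
Lemma frobenius1 : frobenius 1%g = (alt_paths (nseq n 1%N) b)%:~R.
Proof.
have Hn : sumn (nseq n 1%N) = n by rewrite sumn_nseq mul1n.
rewrite -cfdot_frobenius // -cfdot_Res_l cfdotE.
have HE g : (g \in young_group n (nseq n 1%N)) = (g == 1%g).
  apply/young_groupP/eqP => [Hg|-> i]; last by rewrite perm1.
  apply/permP => i; rewrite perm1; apply: ord_inj.
  have ri (j : 'I_n) : reshape_index (nseq n 1%N) j = j.
    have := @flatten_indexKl (nseq n 1%N) j 0; rewrite /flatten_index nth_nseq ltn_ord.
    by rewrite take_nseq ?(ltnW (ltn_ord j)) // sumn_nseq mul1n addn0 => ->.
  by have := Hg i; rewrite !ri.
rewrite (big_pred1 1%g) => [|g]; last exact: HE.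
rewrite (eq_card1 (x := 1%g)) ?invr1 ?mul1r => [|g]; last exact: HE.
by rewrite cfResE ?subsetT ?group1 // cfun1E group1 conjC1 mulr1.
Qed.

(** A virtual character of norm 1 is an irreducible one up to sign, and [frobenius_label] tells
    which. *)
Lemma odd_chi1 : odd (Num.truncn (chi n la 1%g)) = odd `|alt_paths (nseq n 1%N) b|.
Proof.
rewrite /chi; case: pickP => [i /frobenius_label Hi|H] /=; last first.
  have [i Hi1 Hi2] := cfdot_neq0_constt (young_signed_young_neq0 la_sorted la_sum).
  by have := H i; rewrite /is_label Hi1 Hi2.
have [e [j Ej]] := vchar_norm1P frobenius_vchar frobenius_norm.
have Eij : i = j.
  apply/eqP; apply: contraR Hi => ij.
  by rewrite Ej cfdotZl cfdot_irr [j == i]eq_sym (negbTE ij) mulr0.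
have := frobenius1; rewrite Ej -Eij cfunE => E1.
have [d Hd] := natrP (Cnat_irr1 i).
rewrite Hd natrK; congr odd; apply/eqP; rewrite -(eqr_nat algC) natr_absz intr_norm -E1 Hd.
by rewrite normrM normr_sign mul1r normr_nat.
Qed.

End Frobenius.

(** * Degrees modulo 2 and beads *)

Section Parity.
Variables N B : nat.
Local Notation T := {ffun 'I_N -> 'I_B.+1}.
Implicit Types (b c : T) (i j : 'I_N) (a : nat).

Definition parity n b : bool := odd `|alt_paths (nseq n 1) b|.

Lemma odd_abszD (x y : int) : odd `|(x + y)%R| = odd `|x| (+) odd `|y|.
Proof. lia. Qed.

Definition lower b i a : T := [ffun j => inord (b j - (j == i) * a)].

Lemma lowerE b i a j : lower b i a j = b j - (j == i) * a :> nat.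
Proof. by rewrite ffunE inordK // ltnS (leq_trans (leq_subr _ _)) // -ltnS. Qed.

Lemma weight_lower b i a : a <= b i -> weight (lower b i a) + a = weight b.
Proof.
move=> Ha; rewrite /weight (bigD1 i) //= [RHS](bigD1 i) //= lowerE eqxx mul1n.
rewrite (eq_bigr (fun j => b j : nat)) => [|j Hj]; last by rewrite lowerE (negbTE Hj) subn0.
by rewrite addnAC subnK.
Qed.

Lemma parityS n b : parity n.+1 b = \big[addb/false]_(i | 0 < b i) parity n (lower b i 1).
Proof.
rewrite /parity [alt_paths _ _]alt_paths_cons (big_morph _ odd_abszD (erefl _)).
rewrite (eq_bigl (mem [set lower b i 1 | i : 'I_N & 0 < b i])); last first.
  move=> c /=; apply/andP/imsetP => [[/forallP Hc /eqP Hw]|[i Hi ->]]; last first.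
    rewrite inE in Hi; split; last by rewrite weight_lower.
    by apply/forallP => j; rewrite lowerE leq_subr.
  have [i Hi] : exists i, c i < b i.
    apply/existsP; apply: contraT; rewrite negb_exists => /forallP H.
    suff : weight b <= weight c by rewrite -Hw addn1 ltnn.
    by apply: leq_sum => i _; rewrite leqNgt H.
  exists i; first by rewrite inE (leq_ltn_trans _ Hi).
  have Hle j : c j <= lower b i 1 j.
    by rewrite lowerE; case: eqP => [->|_]; rewrite ?mul1n ?subn0 // subn1 -ltnS prednK // (leq_ltn_trans _ Hi).
  have Hwe : weight c = weight (lower b i 1).
    by apply/eqP; rewrite -(eqn_add2r 1) Hw weight_lower // (leq_ltn_trans _ Hi).
  apply/ffunP => j; apply: ord_inj; apply/eqP; move/eqP: Hwe.
  by rewrite (leqif_sum (fun i _ => leqif_eq (Hle i))) => /forall_inP ->.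
rewrite big_imset /=; first by apply: eq_bigl => i; rewrite inE.
move=> i j; rewrite !inE => Hi Hj /ffunP/(_ i)/(congr1 (@nat_of_ord _)).
by rewrite !lowerE eqxx; case: eqP => // _; lia.
Qed.

Lemma lowerD b i a a' : lower (lower b i a) i a' = lower b i (a + a').
Proof. by apply/ffunP => j; apply: ord_inj; rewrite !lowerE mulnDr subnDA. Qed.

Lemma lowerC b i j a a' : lower (lower b i a) j a' = lower (lower b j a') i a.
Proof. by apply/ffunP => k; apply: ord_inj; rewrite !lowerE subnAC. Qed.

(** The terms (i, j) and (j, i) cancel, as the mixed terms do when a sum is squared modulo 2. *)
Lemma xor_symmetric (F : 'I_N -> 'I_N -> bool) : (forall i j, F i j = F j i) ->
  \big[addb/false]_i \big[addb/false]_j F i j = \big[addb/false]_i F i i.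
Proof.
move=> symF.
have E i : \big[addb/false]_j F i j =
   F i i (+) (\big[addb/false]_(j : 'I_N | j < i) F i j (+) \big[addb/false]_(j : 'I_N | i < j) F i j).
  rewrite (bigD1 i) //=; congr (_ (+) _); rewrite (bigID (fun j : 'I_N => j < i)) /=.
  by congr (_ (+) _); apply: eq_bigl => j; rewrite -val_eqE /=; lia.
have EC : \big[addb/false]_(i : 'I_N) \big[addb/false]_(j : 'I_N | j < i) F i j =
          \big[addb/false]_(i : 'I_N) \big[addb/false]_(j : 'I_N | i < j) F i j.
  rewrite (exchange_big_dep xpredT) //=; apply: eq_bigr => i _.
  by apply: eq_bigr => j _; rewrite symF.
by rewrite (eq_bigr _ (fun i _ => E i)) !big_split /= EC addbb addbF.
Qed.

(* (x_1 + ... + x_N)^(2^k) = x_1^(2^k) + ... + x_N^(2^k) modulo 2. *)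
Lemma parity_pow2 k n b : 2 ^ k <= n ->
  parity n b = \big[addb/false]_(i | 2 ^ k <= b i) parity (n - 2 ^ k) (lower b i (2 ^ k)).
Proof.
elim: k n b => [|k IH] n b.
  by case: n => // n _; rewrite parityS subn1.
rewrite expnS mul2n -addnn => Hn.
rewrite IH ?(leq_trans (leq_addr _ _) Hn) //.
transitivity (\big[addb/false]_i \big[addb/false]_j
   ([&& 2 ^ k <= b i, 2 ^ k <= lower b i (2 ^ k) j & parity (n - (2 ^ k + 2 ^ k)) (lower (lower b i (2 ^ k)) j (2 ^ k))])).
  rewrite big_mkcond; apply: eq_bigr => i _; case: ifP => Hi; last by rewrite big1.
  rewrite IH ?leq_subRL ?(leq_trans (leq_addr _ _) Hn) // big_mkcond; apply: eq_bigr => j _.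
  by rewrite subnDA /=; case: ifP.
rewrite xor_symmetric => [|i j].
  rewrite [RHS]big_mkcond; apply: eq_bigr => i _; rewrite lowerD lowerE eqxx mul1n.
  case: ifP => Hi; last by apply/negbTE; lia.
  by rewrite leq_subRL !(leq_trans (leq_addr _ _) Hi) // Hi.
rewrite lowerC !lowerE andbA [RHS]andbA; congr (_ && _).
by rewrite eq_sym; case: eqP => [->|_] //; rewrite mul0n !subn0 andbC.
Qed.

Lemma parity_rep n b i j : i != j -> b i = b j -> parity n b = false.
Proof. by move=> ij E; rewrite /parity (alt_paths_rep _ ij E). Qed.

End Parity.

(** * Parity of the degree in terms of lists of beads *)

Section BeadParity.
Implicit Types (s : seq nat) (x y n k : nat).

Definition move x y s := [seq if z == x then y else z | z <- s].

(* The coefficient of x^s in a_delta(x) (x_1 + ... + x_N)^n modulo 2, where N = size s. *)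
Fixpoint odd_beads n s : bool :=
  uniq s &&
  if n is n'.+1 then foldr addb false [seq odd_beads n' (move x x.-1 s) | x <- s & 0 < x]
  else all (fun x => x < size s) s.

Lemma odd_beadsS n s : odd_beads n.+1 s =
  uniq s && \big[addb/false]_(x <- s | 0 < x) odd_beads n (move x x.-1 s).
Proof. by rewrite /= foldrE big_map big_filter. Qed.

Lemma odd_beads_uniq n s : odd_beads n s -> uniq s.
Proof. by case: n => [|n] /= /andP[]. Qed.

Lemma odd_beads_perm n s s' : perm_eq s s' -> odd_beads n s = odd_beads n s'.
Proof.
elim: n s s' => [|n IH] s s' Hs.
  by rewrite /= (perm_uniq Hs) (perm_all _ Hs) (perm_size Hs).
rewrite !odd_beadsS (perm_uniq Hs); congr (_ && _).
rewrite (perm_big _ Hs) /=; apply: eq_bigr => x _; apply: IH; exact: perm_map.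
Qed.

(** An additional empty part changes nothing: the new bead 0 cannot move, and it blocks the bead at
    1, which comes from a bead at 0 that could not move either. *)
Lemma odd_beads_add n s : odd_beads n (0 :: map S s) = odd_beads n s.
Proof.
elim: n s => [|n IH] s.
  rewrite /= all_map (map_inj_uniq succn_inj) size_map.
  by rewrite (_ : 0 \in _ = false) //; apply/negbTE/negP => /mapP[].
rewrite !odd_beadsS /= (map_inj_uniq succn_inj) (_ : 0 \in _ = false); last first.
  by apply/negbTE/negP => /mapP[].
rewrite big_cons /= big_map; case Us : (uniq s) => //=.
rewrite [RHS]big_mkcond; apply: eq_big_seq => x xs; case: ifP => [x0|x0]; last first.
  have -> : x = 0 by lia.
  apply/negbTE/negP => /odd_beads_uniq; rewrite /move /= => /andP[/negP H _]; apply: H.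
  apply/mapP; exists 1 => //; apply/mapP; exists 0 => //; by have <- : x = 0 by lia.
rewrite -[RHS]IH; congr odd_beads; rewrite /move /= -!map_comp; congr (_ :: _).
by apply: eq_map => z /=; rewrite eqSS; case: eqP => //; rewrite prednK.
Qed.

Section Link.
Variables N B : nat.
Local Notation T := {ffun 'I_N -> 'I_B.+1}.
Implicit Types b : T.

Definition bead_seq b : seq nat := [seq (b i : nat) | i : 'I_N].

Lemma size_bead_seq b : size (bead_seq b) = N.
Proof. by rewrite size_map size_enum_ord. Qed.

Lemma bead_seq_lower b i a : uniq (bead_seq b) ->
  bead_seq (lower b i a) = move (b i) (b i - a) (bead_seq b).
Proof.
move=> Ub; rewrite /move -map_comp; apply: eq_map => j /=; rewrite lowerE.
have [->|ij] := eqVneq j i; first by rewrite eqxx mul1n.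
case: eqP => [E|]; last by rewrite subn0.
case/eqP: ij; apply: (@injectiveP _ _ (fun i => b i : nat) _ _ _ E).
by rewrite /injectiveb /dinjectiveb.
Qed.

(** For n = 0 the coefficient of x^b in a_delta is nonzero exactly if [b] permutes delta, that is,
    if its entries are distinct and below N. *)
Lemma parity_bead_seq n b : parity n b = odd_beads n (bead_seq b).
Proof.
elim: n b => [|n IH] b; last first.
  rewrite parityS odd_beadsS; case: (boolP (uniq _)) => Ub /=; last first.
    have [i [j ij E]] : exists i, exists2 j, i != j & (b i : nat) = b j.
      by apply/injectivePn.
    by rewrite -parityS (parity_rep _ ij (ord_inj E)).
  rewrite [RHS]big_map [RHS]big_enum_cond /=; apply: eq_bigr => i _.
  by rewrite IH bead_seq_lower // subn1.
rewrite /= size_bead_seq; case: (boolP (uniq _)) => Ub /=; last first.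
  have [i [j ij E]] : exists i, exists2 j, i != j & (b i : nat) = b j.
    by apply/injectivePn.
  by rewrite (parity_rep _ ij (ord_inj E)).
have injb : injective (fun i => b i : nat) by apply/injectiveP.
rewrite /parity /alt_paths /=; case: allP => [Hall|Hall]; last first.
  rewrite big1 // => w _; case: (boolP [forall i, _]) => [/forallP H|_]; last by rewrite mulr0.
  case: Hall => _ /mapP[i _ ->]; rewrite -(eqP (H i)); exact: (ltn_ord (rev_ord (w i))).
have Hlt i : b i < N by apply: Hall; apply: map_f; rewrite mem_enum.
have injw : injective (fun i => rev_ord (Ordinal (Hlt i))).
  by move=> i j /rev_ord_inj /(congr1 val) /= /injb.
rewrite (bigD1 (perm injw)) //= big1 ?addr0 => [|w Hw].
  case: (boolP [forall i, _]) => [_|/negP[]]; first by case: odd_perm.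
  by apply/forallP => i; rewrite permE /=; have := Hlt i; lia.
case: (boolP [forall i, _]) => [/forallP H|_]; last by rewrite mulr0.
case/eqP: Hw; apply/permP => i; rewrite permE -[LHS]rev_ordK; congr rev_ord.
apply: ord_inj; exact: (eqP (H i)).
Qed.

End Link.

Lemma odd_beads_pow2 k n s : uniq s -> 2 ^ k <= n ->
  odd_beads n s = \big[addb/false]_(x <- s | 2 ^ k <= x) odd_beads (n - 2 ^ k) (move x (x - 2 ^ k) s).
Proof.
move=> Us Hn; pose b : {ffun 'I_(size s) -> 'I_(sumn s).+1} := [ffun i : 'I_(size s) => inord (nth 0 s i)].
have Eb : bead_seq b = s.
  apply: (@eq_from_nth _ 0); rewrite size_bead_seq // => i Hi.
  rewrite (nth_map (Ordinal Hi)) ?size_enum_ord // (nth_ord_enum _ (Ordinal Hi)).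
  by rewrite ffunE inordK // ltnS nth_le_sumn.
rewrite -{1}Eb -parity_bead_seq (parity_pow2 _ Hn).
have E F : \big[addb/false]_(x <- s | 2 ^ k <= x) F x =
           \big[addb/false]_(x <- bead_seq b | 2 ^ k <= x) F x by rewrite Eb.
rewrite E big_map big_enum_cond /=.
by apply: eq_bigr => i _; rewrite parity_bead_seq bead_seq_lower Eb.
Qed.

Definition beads N (la : seq nat) := mkseq (fun i => nth 0 la i + (N - i.+1)) N.

Lemma beadsS N la : size la <= N -> beads N.+1 la = rcons (map S (beads N la)) 0.
Proof.
move=> HN; rewrite /beads /mkseq -addn1 iotaD map_cat /= cats1 -map_comp add0n; congr rcons.
  by apply/eq_in_map => i; rewrite mem_iota /=; lia.
by rewrite nth_default //; lia.
Qed.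

(** The number of beads is free, so a partition and all partitions obtained from it can be written
    with the same N. *)
Lemma odd_partitionE N n la : size la <= N ->
  odd_partition n la = is_partition n la && odd_beads n (beads N la).
Proof.
move=> HN; rewrite /odd_partition; case Hp : (is_partition n la) => //=.
case/and3P: Hp => Hs _ /eqP Hn; rewrite (odd_chi1 Hs Hn) -[odd _]/(parity n _) parity_bead_seq.
have -> : bead_seq (bead_fun n la) = beads (size la) la.
  rewrite /bead_seq /beads /mkseq -val_enum_ord -map_comp; apply: eq_map => i.
  by rewrite (bead_funE Hn).
elim: N HN => [|N IH]; first by rewrite leqn0 => /eqP ->.
rewrite leq_eqVlt => /orP[/eqP -> //|]; rewrite ltnS => HN.
by rewrite IH // beadsS // -odd_beads_add; apply/odd_beads_perm; rewrite perm_sym perm_rcons.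
Qed.

End BeadParity.

(** * Finite sets of beads *)

Section BeadSets.
Implicit Types (X Y : {fset nat}) (x y n h k : nat) (la : seq nat).

Definition fmove x y X : {fset nat} := (y |` (X `\ x))%fset.

Lemma in_fmove x y X z : (z \in fmove x y X) = (z == y) || ((z != x) && (z \in X)).
Proof. by rewrite !inE. Qed.

Definition can_move h X x := [&& x \in X, h <= x & x - h \notin X].

Lemma card_fmove x y X : x \in X -> y \notin X -> (#|` fmove x y X| = #|` X|)%fset.
Proof.
by move=> Hx Hy; rewrite cardfsU1 !inE (negbTE Hy) andbF (cardfsD1 x X) Hx.
Qed.

Lemma perm_move x y X : x \in X -> y \notin X -> perm_eq (move x y X) (fmove x y X).
Proof.
move=> Hx Hy; apply: uniq_perm; last 1 first.
- move=> z; rewrite in_fmove; apply/mapP/idP => [[w Hw ->]|/orP[/eqP ->|/andP[zx zX]]].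
  + by case: (eqVneq w x) => [_|ne]; rewrite ?eqxx ?Hw ?ne ?orbT.
  + by exists x; rewrite ?eqxx.
  + by exists z; rewrite ?(negbTE zx).
- rewrite map_inj_in_uniq ?fset_uniq // => a b Ha Hb.
  case: eqP => [->|_]; case: eqP => [->|_] // E; first by rewrite E Hb in Hy.
  by rewrite -E Ha in Hy.
exact: fset_uniq.
Qed.

(** A move onto an occupied position produces a repeated bead and contributes 0; what remains are
    moves between sets. *)
Lemma odd_beads_fset_pow2 k n X : 2 ^ k <= n ->
  odd_beads n X = \big[addb/false]_(x <- X | (2 ^ k <= x) && (x - 2 ^ k \notin X))
     odd_beads (n - 2 ^ k) (fmove x (x - 2 ^ k) X).
Proof.
move=> Hn; rewrite (odd_beads_pow2 _ Hn) ?fset_uniq // big_seq_cond [RHS]big_seq_cond.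
rewrite (bigID (fun x => x - 2 ^ k \in X)) /= big1 => [|x /andP[/andP[Hx Hkx] Hin]].
  rewrite addFb; apply: eq_big => [x|x /andP[/andP[Hx Hkx] Hin]]; first by rewrite andbA.
  exact/odd_beads_perm/perm_move.
apply/negbTE/negP => /odd_beads_uniq H.
have ne : x != x - 2 ^ k by have := expn_gt0 2 k; lia.
have := nth_uniq 0 (i := index x X) (j := index (x - 2 ^ k) X) _ _ H.
rewrite size_map !index_mem => /(_ Hx Hin); rewrite !(nth_map 0) ?index_mem // !nth_index //.
rewrite eqxx [_ == x]eq_sym (negbTE ne) eqxx => /esym/eqP E.
by case/eqP: ne; rewrite -[LHS](nth_index 0 Hx) -[RHS](nth_index 0 Hin) E.
Qed.

Definition bead_sum X := \sum_(x <- X) x.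
(** Taking 0 + 1 + 2 + ... off the sum of the beads leaves the sum of the parts, so [X] encodes a
    partition of [n]; [bead_set_surj] produces it. *)
Definition bead_size n X := bead_sum X = n + \sum_(0 <= i < #|` X|%fset) i.

Lemma bead_sum_fmove x y X : x \in X -> y \notin X -> bead_sum (fmove x y X) + x = bead_sum X + y.
Proof.
move=> Hx Hy; rewrite /bead_sum -(perm_big _ (perm_move Hx Hy)) /= big_map.
rewrite (big_rem x) //= eqxx [in RHS](big_rem x) //=.
have aux S : y + S + x = x + S + y by lia.
rewrite (eq_big_seq id) => [|z]; first exact: aux.
by rewrite mem_rem_uniq ?fset_uniq // inE => /andP[/negbTE ->].
Qed.

Lemma bead_sum_ge X : \sum_(0 <= i < #|` X|%fset) i <= bead_sum X.
Proof.
have Ht : sorted ltn (sort leq X).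
  by rewrite ltn_sorted_uniq_leq sort_uniq fset_uniq sort_sorted //; exact: leq_total.
rewrite /bead_sum -(perm_big _ (permEl (perm_sort leq X))) [X in _ <= X](big_nth 0) size_sort big_nat [X in _ <= X]big_nat.
apply: leq_sum => i /= Hi; elim: i Hi => // i IH Hi.
apply: leq_ltn_trans (IH (ltnW Hi)) _.
by apply: (sorted_ltn_nth ltn_trans) => //; rewrite inE size_sort // ltnW.
Qed.

(** After the move there are as many distinct beads as before, so their sum is still at least 0 + 1
    + 2 + ... *)
Lemma can_move_size n h X x : bead_size n X -> can_move h X x -> h <= n.
Proof.
move=> HX /and3P[Hx Hh Hn]; have := bead_sum_ge (fmove x (x - h) X).
by rewrite card_fmove //; have := bead_sum_fmove Hx Hn; rewrite HX; lia.
Qed.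

Lemma bead_size_fmove n h X x : bead_size n X -> can_move h X x ->
  bead_size (n - h) (fmove x (x - h) X).
Proof.
move=> HX Hm; have Hhn := can_move_size HX Hm; case/and3P: Hm => Hx Hh Hn.
by rewrite /bead_size card_fmove //; have := bead_sum_fmove Hx Hn; rewrite HX; lia.
Qed.

Lemma odd_beads_child k n X : 2 ^ k <= n -> odd_beads n X ->
  exists2 x, can_move (2 ^ k) X x & odd_beads (n - 2 ^ k) (fmove x (x - 2 ^ k) X).
Proof.
move=> Hn; rewrite (odd_beads_fset_pow2 _ Hn) => H.
have [|/hasPn Hno] := boolP (has (fun x => (2 ^ k <= x) && (x - 2 ^ k \notin X) &&
    odd_beads (n - 2 ^ k) (fmove x (x - 2 ^ k) X)) X).
  by case/hasP => x Hx /andP[/andP[H1 H2] H3]; exists x; rewrite // /can_move Hx H1.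
move: H; rewrite big_seq_cond big1 // => x /andP[Hx Hc].
by apply/negbTE; have := Hno x Hx; rewrite Hc.
Qed.

Lemma odd_beads_size n X : odd_beads n X -> bead_size n X.
Proof.
elim: n X => [|n IH] X.
  move=> /= /andP[_ /allP Hall]; rewrite /bead_size add0n /bead_sum.
  apply: perm_big; apply: uniq_perm; rewrite ?fset_uniq ?iota_uniq //.
  apply: (uniq_min_size _ _ _).2; rewrite ?fset_uniq // ?size_iota ?subn0 //.
  by move=> x /Hall Hx; rewrite mem_iota subn0.
move=> /(odd_beads_child (k := 0) (ltn0Sn n))[x Hm]; rewrite subn1 => /IH.
case/and3P: Hm => Hx Hh Hn; rewrite /bead_size card_fmove //.
by have := bead_sum_fmove Hx Hn; rewrite expn0 in Hh *; lia.
Qed.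


Definition bead_set N la : {fset nat} := [fset x in beads N la]%fset.


End BeadSets.

(** * Hook removal *)

Section HookRemoval.
Variables (N : nat) (la : seq nat).
Implicit Types (r c i x y h n : nat) (b : nat * nat).

Definition bead (mu : nat -> nat) i := mu i + (N - i.+1).
Local Notation bd i := (bead (nth 0 la) i).

Lemma bead_decr (mu : nat -> nat) i j : {homo mu : a b / a <= b >-> b <= a} ->
  i < j -> j < N -> bead mu j < bead mu i.
Proof. by rewrite /bead => Hmu ij jN; have := Hmu _ _ (ltnW ij); lia. Qed.

Hypotheses (la_sorted : sorted geq la) (la_size : size la <= N).

Lemma nth_geq : {homo nth 0 la : a b / a <= b >-> b <= a}.
Proof. by move=> a b; apply: sorted_geq_nth. Qed.

Lemma in_bead_setP x : reflect (exists2 i, i < N & x = bd i) (x \in bead_set N la).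
Proof.
rewrite in_fset /=; apply: (iffP mapP) => -[i Hi ->]; exists i => //.
  by move: Hi; rewrite mem_iota.
by rewrite mem_iota.
Qed.

(** Row i after removal of the rim hook. With q the length of column c, rows r to q - 2 become the
    next row less one box, and row q - 1 keeps c boxes. *)
Definition cut r c i :=
  if i < r then nth 0 la i
  else if i.+1 < nth 0 (conj_part la) c then (nth 0 la i.+1).-1
  else if i < nth 0 (conj_part la) c then c else nth 0 la i.

Lemma count_lt_iota m k : count (fun x => x < m) (iota 0 k) = minn k m.
Proof.
elim: k => [|k IH]; first by rewrite min0n.
rewrite -addn1 iotaD count_cat IH /= add0n addn0 /minn.
by case: (ltnP k m) => ?; case: (ltnP (k + 1) m) => ? /=; lia.
Qed.

Lemma cut_count r c i :
  count (fun c' => ~~ in_rim_hook la (r, c) i c') (iota 0 (nth 0 la i)) = cut r c i.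
Proof.
rewrite /cut ltnNge; case: (boolP (r <= i)) => [ri|ri] /=; last first.
  rewrite (eq_count (a2 := xpredT)) ?count_predT ?size_iota // => c'.
  by rewrite /in_rim_hook /= (negbTE ri).
(* A box of row i is on the rim iff the next row has length at most c' + 1; the boxes that stay are
   therefore the columns below this maximum. *)
have -> : count (fun c' => ~~ in_rim_hook la (r, c) i c') (iota 0 (nth 0 la i)) =
   count (fun x => x < maxn c (nth 0 la i.+1).-1) (iota 0 (nth 0 la i)).
  apply: eq_in_count => c'; rewrite mem_iota /in_rim_hook /in_diagram /= ri /=; lia.
rewrite count_lt_iota !conj_partP //; have := nth_geq (leqnSn i); do 2!case: ltnP; lia.
Qed.

Lemma cut_mono r c : r < nth 0 (conj_part la) c -> {homo cut r c : a b / a <= b >-> b <= a}.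
Proof.
move=> Hr; apply: homo_leq => [x|x y z H1 H2|i]; [exact: leqnn|exact: leq_trans H2 H1|].
rewrite /cut; have := nth_geq (leqnSn i); have := nth_geq (leqnSn i.+1).
have := conj_partP i c la_sorted; have := conj_partP i.+1 c la_sorted.
have := conj_partP i.+2 c la_sorted; move: Hr; move: (nth 0 (conj_part la) c) => q.
by case: (ltnP i r) => ?; case: (ltnP i.+1 r) => ?; case: (ltnP i q) => ?;
  case: (ltnP i.+1 q) => ?; case: (ltnP i.+2 q) => ?; lia.
Qed.

Lemma nth_filter_pos (s : seq nat) i : sorted geq s -> nth 0 [seq x <- s | 0 < x] i = nth 0 s i.
Proof.
elim: s i => [|a s IH] i //= Hs.
have Hs' := path_sorted Hs.
case: posnP => [a0|a0]; last by case: i => //= i; apply: IH.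
have Hall : all (pred1 0) s.
  have := order_path_min (fun x y z H1 H2 => leq_trans H2 H1) Hs.
  by apply: sub_all => x /=; rewrite a0 leqn0.
have -> : [seq x <- s | 0 < x] = [::].
  by apply/eqP; rewrite -(negbK (_ == _)) -has_filter -all_predC; apply: sub_all Hall => x /= /eqP ->.
rewrite a0; case: i => //= i; rewrite ?nth_nil.
by have [Hi|Hi] := ltnP i (size s); [apply/esym/eqP; apply: (allP Hall); apply: mem_nth|rewrite nth_default].
Qed.

Lemma remove_hookE r c : r < nth 0 (conj_part la) c ->
  let mu := remove_hook la (r, c) in
  [/\ sorted geq mu, 0 \notin mu, size mu <= N & forall i, nth 0 mu i = cut r c i].
Proof.
move=> Hr /=; rewrite /remove_hook.
rewrite (eq_mkseq (g := cut r c)) => [|i]; last exact: cut_count.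
have Hs : sorted geq (mkseq (cut r c) (size la)).
  apply: (path_sorted (x := cut r c 0)); apply/(pathP 0) => i; rewrite size_mkseq => Hi.
  case: i Hi => [|i] Hi /=; first by rewrite nth_mkseq //; apply: cut_mono.
  by rewrite !nth_mkseq //; [apply: cut_mono | apply: ltnW].
split.
- by apply: sorted_filter => // x y z H1 H2; apply: leq_trans H2 H1.
- by rewrite mem_filter ltnn.
- by rewrite size_filter (leq_trans (count_size _ _)) // size_mkseq.
move=> i; rewrite nth_filter_pos //; have [Hi|Hi] := ltnP i (size la).
  by rewrite nth_mkseq.
rewrite nth_default ?size_mkseq // /cut.
have Hz j : size la <= j -> nth 0 la j = 0 by move=> ?; rewrite nth_default.
have Hrs : r < size la by apply: leq_trans Hr (nth_conj_le_size c la_sorted).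
move: (nth_conj_le_size c la_sorted); set q := nth 0 (conj_part la) c => Hq.
case: (ltnP i r) => ?; first by lia.
case: (ltnP i.+1 q) => ?; first by lia.
by case: (ltnP i q) => ?; [lia | rewrite Hz].
Qed.

Lemma hook_lengthE r c : hook_length la (r, c) =
  (nth 0 la r - c.+1) + (nth 0 (conj_part la) c - r.+1) + 1.
Proof. by []. Qed.

Lemma remove_hook_beads r c : c < nth 0 la r ->
  let h := hook_length la (r, c) in
  [/\ can_move h (bead_set N la) (bd r)
    & bead_set N (remove_hook la (r, c)) = fmove (bd r) (bd r - h) (bead_set N la)].
Proof.
move=> Hc h; have Hr : r < nth 0 (conj_part la) c by rewrite conj_partP.
set q := nth 0 (conj_part la) c in Hr.
have qP i : (i < q) = (c < nth 0 la i) by rewrite conj_partP.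
have qN : q <= N by apply: leq_trans la_size; apply: nth_conj_le_size.
have [Hs _ Hsz Hmu] := remove_hookE Hr.
have Ey : bd r - h = c + (N - q) by rewrite /h hook_lengthE /bead -/q; lia.
have Hhr : h <= bd r by rewrite /h hook_lengthE /bead -/q; lia.
have Hrin : bd r \in bead_set N la by apply/in_bead_setP; exists r => //; lia.
have Hnotin : bd r - h \notin bead_set N la.
  apply/in_bead_setP => -[i Hi]; rewrite Ey /bead; have := qP i; case: ltnP; lia.
split; first by rewrite /can_move Hrin Hhr.
have Ubs mu : {homo mu : a b / a <= b >-> b <= a} -> #|` [fset x in mkseq (bead mu) N]%fset|%fset = N.
  move=> Hm; rewrite card_fseq undup_id ?size_mkseq //; apply/mkseq_uniqP => i j /= Hi Hj E.
  by have := @bead_decr mu i j Hm; have := @bead_decr mu j i Hm; rewrite !inE in Hi Hj; lia.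
(* Equal cardinalities leave one inclusion, checked row by row. *)
apply/eqP; rewrite eqEfcard; apply/andP; split; last first.
  rewrite card_fmove // /bead_set.
  apply: eq_leq; apply: etrans (Ubs _ nth_geq) (esym _).
  by apply: (Ubs (nth 0 (remove_hook la (r, c)))) => a b; apply: sorted_geq_nth.
apply/fsubsetP => z; rewrite in_fset in_fmove Ey => /mapP[i]; rewrite mem_iota => /andP[_ Hi] ->.
rewrite Hmu /cut -/q; case: (ltnP i r) => [ir|ri].
  apply/orP; right; apply/andP; split; last by apply/in_bead_setP; exists i.
  by have := bead_decr nth_geq ir; rewrite /bead; lia.
case: (ltnP i.+1 q) => iq.
  apply/orP; right; apply/andP; split.
    by have := @bead_decr _ r i.+1 nth_geq; rewrite /bead; have := qP i.+1; lia.
  by apply/in_bead_setP; exists i.+1; [lia | rewrite /bead; have := qP i.+1; lia].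
case: (ltnP i q) => iq'; first by apply/orP; left; apply/eqP; lia.
apply/orP; right; apply/andP; split; last by apply/in_bead_setP; exists i.
by have := @bead_decr _ r i nth_geq; rewrite /bead; lia.
Qed.

Lemma can_move_hook h x : 0 < h -> can_move h (bead_set N la) x ->
  exists r c, [/\ c < nth 0 la r, hook_length la (r, c) = h & x = bd r].
Proof.
move=> h0 /and3P[/in_bead_setP[r rN ->] Hh Hy].
pose P q := (N <= q) || (bd q < bd r - h).
have exP : exists q, P q by exists N; rewrite /P leqnn.
case: (ex_minnP exP) => q Pq minq.
have qN : q <= N by apply: minq; rewrite /P leqnn.
have Hlt i : i < q -> bd r - h < bd i.
  move=> iq; have iN := leq_trans iq qN.
  have : ~~ P i by apply/negP => /minq; rewrite leqNgt iq.
  rewrite /P negb_or -[X in _ && X]leqNgt [bd r - h <= _]leq_eqVlt => /andP[_ /orP[/eqP E|//]].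
  by case/in_bead_setP: Hy; exists i.
have rq : r < q.
  rewrite ltnNge; apply/negP => qr; case/orP: Pq => [|Hq]; first by lia.
  move: qr; rewrite leq_eqVlt => /orP[/eqP E|qr]; first by move: Hq; rewrite E; lia.
  by have := bead_decr nth_geq qr rN; lia.
have Hyq : N - q <= bd r - h.
  case/orP: Pq => [|]; first by lia.
  by rewrite /bead; lia.
(* Exactly [N - q] beads lie below the target; the number of free positions below it is the column
   of the hook. *)
exists r, (bd r - h - (N - q)).
have Hq1 : bd r - h < bd q.-1 by apply: Hlt; lia.
have Hqm : nth 0 la q.-1 <= nth 0 la r by apply: nth_geq; lia.
have Hcr : bd r - h - (N - q) < nth 0 la r.
  by move: Hq1 Hqm Hyq; rewrite /bead; lia.
split => //; rewrite hook_lengthE.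
suff -> : nth 0 (conj_part la) (bd r - h - (N - q)) = q by move: Hcr Hh Hyq; rewrite /bead; lia.
set c := bd r - h - (N - q) in Hcr *.
have H1 : (q < nth 0 (conj_part la) c) = false.
  rewrite conj_partP //; case/orP: Pq => [Nq|]; last by rewrite /c /bead; lia.
  by rewrite nth_default //; lia.
have H2 : q.-1 < nth 0 (conj_part la) c.
  by rewrite conj_partP // /c; move: Hq1 Hyq; rewrite /bead; lia.
lia.
Qed.

End HookRemoval.

(** * The maps [f] on bead sets *)

Section HookMap.
Implicit Types (la mu : seq nat) (X Y : {fset nat}) (n k N : nat).

Lemma beads_sorted N la : sorted geq la -> sorted gtn (beads N la).
Proof.
move=> Hs; apply: (@path_sorted _ gtn (bead N (nth 0 la) 0 + 1)); apply/(pathP 0) => i.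
rewrite size_mkseq => Hi; rewrite nth_mkseq //; case: i Hi => [|i] Hi /=.
  by rewrite /bead; lia.
by rewrite nth_mkseq ?(ltnW Hi) //; apply: (@bead_decr N _ i i.+1 (nth_geq Hs)).
Qed.

Lemma gtn_sorted_uniq (s : seq nat) : sorted gtn s -> uniq s.
Proof. by rewrite gtn_sorted_uniq_geq => /andP[]. Qed.

Lemma perm_bead_set N la : sorted geq la -> perm_eq (bead_set N la) (beads N la).
Proof.
move=> Hs; apply: uniq_perm; rewrite ?fset_uniq ?(gtn_sorted_uniq (beads_sorted _ Hs)) //.
by move=> x; rewrite in_fset.
Qed.

Lemma card_bead_set N la : sorted geq la -> #|` bead_set N la|%fset = N.
Proof. by move=> /(perm_bead_set N) /perm_size ->; rewrite size_mkseq. Qed.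

Lemma bead_size_bead_set n N la : sorted geq la -> size la <= N ->
  bead_size n (bead_set N la) <-> sumn la = n.
Proof.
move=> Hs HN; rewrite /bead_size card_bead_set // /bead_sum (perm_big _ (perm_bead_set N Hs)) /=.
have -> : \sum_(x <- beads N la) x = sumn la + \sum_(0 <= i < N) i.
  rewrite big_map /= (_ : iota 0 N = index_iota 0 N) ?big_split /=; last by rewrite /index_iota subn0.
  rewrite [in RHS]big_nat_rev /=; congr (_ + _).
  rewrite sumn_nth -(big_mkord xpredT (nth 0 la)) [RHS](big_nat_widen _ _ _ _ _ HN) /=.
  rewrite [RHS]big_mkcond; apply: eq_bigr => i _; case: ltnP => // Hi.
  by rewrite nth_default.
by split=> [|->] // /eqP; rewrite eqn_add2r => /eqP.
Qed.

Lemma odd_partition_bead_set N n la : size la <= N ->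
  odd_partition n la = is_partition n la && odd_beads n (bead_set N la).
Proof.
move=> HN; rewrite (odd_partitionE _ HN); case Hp : is_partition => //=.
by case/and3P: Hp => Hs _ _; rewrite (odd_beads_perm _ (perm_bead_set N Hs)).
Qed.

Lemma remove_hook_partition n la r c : is_partition n la -> c < nth 0 la r ->
  is_partition (n - hook_length la (r, c)) (remove_hook la (r, c)).
Proof.
case/and3P=> Hs H0 /eqP Hn Hc.
have Hr : r < nth 0 (conj_part la) c by rewrite conj_partP.
have [Hs' H0' Hsz _] := remove_hookE Hs (leqnn _) Hr.
rewrite /is_partition Hs' H0' /=; apply/eqP.
have [Hm E] := remove_hook_beads Hs (leqnn _) Hc.
apply/(bead_size_bead_set _ Hs' Hsz); rewrite E; apply: bead_size_fmove Hm.
exact/(bead_size_bead_set _ Hs (leqnn _)).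
Qed.

(** An odd child exists by parity and comes from a box by [can_move_hook]. The filtered list is thus
    nonempty, and its head has the properties shared by all members. *)
Lemma f_spec N n k la : size la <= N -> odd_partition n la -> 2 ^ k <= n ->
  [/\ odd_partition (n - 2 ^ k) (f n k la), size (f n k la) <= N &
    exists2 x, can_move (2 ^ k) (bead_set N la) x &
       bead_set N (f n k la) = fmove x (x - 2 ^ k) (bead_set N la)].
Proof.
move=> HN Hla Hk; set s := [seq remove_hook la b | b <- boxes la
       & (hook_length la b == 2 ^ k) && odd_partition (n - 2 ^ k) (remove_hook la b)].
have [Hp Ho] : is_partition n la /\ odd_beads n (bead_set N la).
  by apply/andP; rewrite -odd_partition_bead_set.
have [Hs _ _] := and3P Hp.
have box_in r c : ((r, c) \in boxes la) = (c < nth 0 la r).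
  apply/allpairsPdep/idP => [[r' [c' [_]]]|Hc]; first by rewrite mem_iota => /= Hc [-> ->].
  exists r, c; rewrite !mem_iota /= Hc; split=> //.
  by rewrite ltnNge; apply/negP => H; rewrite nth_default in Hc.
have all_s mu : mu \in s -> [/\ odd_partition (n - 2 ^ k) mu, size mu <= N &
    exists2 x, can_move (2 ^ k) (bead_set N la) x &
       bead_set N mu = fmove x (x - 2 ^ k) (bead_set N la)].
  case/mapP => -[r c]; rewrite mem_filter box_in => /andP[/andP[/eqP Hh Ho'] Hc] ->.
  have Hr : r < nth 0 (conj_part la) c by rewrite conj_partP.
  have [_ _ Hsz _] := remove_hookE Hs HN Hr.
  have [Hm E] := remove_hook_beads Hs HN Hc; rewrite Hh in Hm E.
  by split=> //; exists (bead N (nth 0 la) r).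
have [x Hx Hox] := odd_beads_child Hk Ho.
have [r [c [Hc Hh Ex]]] := can_move_hook Hs HN (expn_gt0 2 k) Hx.
have Hr : r < nth 0 (conj_part la) c by rewrite conj_partP.
have in_s : remove_hook la (r, c) \in s.
  apply: map_f; rewrite mem_filter box_in Hc Hh eqxx /= andbT.
  have [_ _ Hsz _] := remove_hookE Hs HN Hr.
  rewrite (odd_partition_bead_set _ Hsz) -{1}Hh remove_hook_partition //=.
  by have [_ ->] := remove_hook_beads Hs HN Hc; rewrite Hh -Ex.
have : f n k la \in s by rewrite /f -/s; case: s in_s {all_s} => // a s' _; rewrite mem_head.
exact: all_s.
Qed.

Lemma bead_set_inj n N la mu : is_partition n la -> is_partition n mu ->
  size la <= N -> size mu <= N -> bead_set N la = bead_set N mu -> la = mu.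
Proof.
move=> /and3P[Hs H0 _] /and3P[Hs' H0' _] HN HN' E.
have Eb : beads N la = beads N mu.
  apply: (irr_sorted_eq (leT := gtn)) => [x y z H1 H2|x|||x].
  - exact: ltn_trans H2 H1.
  - exact: ltnn.
  - exact: beads_sorted.
  - exact: beads_sorted.
  - by rewrite -(perm_mem (perm_bead_set N Hs)) E (perm_mem (perm_bead_set N Hs')).
have En i : nth 0 la i = nth 0 mu i.
  have [Hi|Hi] := ltnP i N; last by rewrite !nth_default // (leq_trans _ Hi).
  by have := congr1 (fun s => nth 0 s i) Eb; rewrite !nth_mkseq // => /addIn.
have pos s i : 0 \notin s -> i < size s -> nth 0 s i != 0.
  by move=> Hs0 Hi; apply: contraNneq Hs0 => <-; rewrite mem_nth.
apply: (@eq_from_nth _ 0) => [|i _]; last exact: En.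
apply/eqP; rewrite eqn_leq; apply/andP; split; rewrite leqNgt; apply/negP => H.
  by have := pos _ _ H0 H; rewrite En nth_default ?eqxx.
by have := pos _ _ H0' H; rewrite -En nth_default ?eqxx.
Qed.

Lemma bead_set_surj n X : bead_size n X ->
  exists2 la, is_partition n la & size la <= #|` X|%fset /\ bead_set #|` X|%fset la = X.
Proof.
move=> HX; set N := #|` X|%fset; pose t := sort geq X.
have Ut : uniq t by rewrite sort_uniq fset_uniq.
have St : size t = N by rewrite size_sort.
have Gt : sorted gtn t.
  by rewrite gtn_sorted_uniq_geq Ut sort_sorted // => x y; exact: leq_total.
have trg : transitive gtn by move=> x y z H1 H2; exact: ltn_trans H2 H1.
have t_decr i j : i < j -> j < N -> nth 0 t j < nth 0 t i.
  move=> ij jN; have := sorted_ltn_nth trg 0 Gt; apply => //; rewrite inE St //.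
  exact: ltn_trans jN.
have t_ge i : i < N -> N - i.+1 <= nth 0 t i.
  move E: (N - i.+1) => d; elim: d i E => [//|d IH] i E iN.
  have i1N : i.+1 < N by lia.
  by have := IH i.+1 _ i1N; have := t_decr _ _ (ltnSn i) i1N; lia.
pose nu := mkseq (fun i => nth 0 t i - (N - i.+1)) N.
have Gnu : sorted geq nu.
  apply: (@path_sorted _ geq (nth 0 t 0 - (N - 1))); apply/(pathP 0) => i.
  rewrite size_mkseq => Hi; rewrite nth_mkseq //; case: i Hi => [|i] Hi //=.
  rewrite nth_mkseq ?(ltnW Hi) //; have := t_decr _ _ (ltnSn i) Hi; lia.
pose la := [seq x <- nu | 0 < x].
have Hs : sorted geq la by apply: sorted_filter => // x y z H1 H2; apply: leq_trans H2 H1.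
have Hsz : size la <= N by rewrite size_filter (leq_trans (count_size _ _)) // size_mkseq.
have EX : bead_set N la = X.
  apply/fsetP => x; rewrite in_fset /= -(mem_sort geq X) -/t; congr (x \in _).
  apply: (@eq_from_nth _ 0); rewrite size_mkseq ?St // => i Hi.
  rewrite nth_mkseq // nth_filter_pos // nth_mkseq // subnK //; exact: t_ge.
exists la => //; rewrite /is_partition Hs mem_filter ltnn /=; apply/eqP.
by apply/(bead_size_bead_set n Hs Hsz); rewrite EX.
Qed.

End HookMap.

(** * The odd child of an odd partition *)

Section Steps.
Implicit Types (X Y Z : {fset nat}) (n m h k t x y p : nat).

Lemma fmoveK x y X : x \in X -> y \notin X -> fmove y x (fmove x y X) = X.
Proof.
move=> Hx Hy; apply/fsetP => z; rewrite !in_fmove.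
have [->|zx] := eqVneq z x; first by rewrite Hx.
by have [->|zy] := eqVneq z y; rewrite //= (negbTE Hy).
Qed.

Lemma odd_beads_moves k n X (s : seq nat) : 2 ^ k <= n -> uniq s ->
  (forall x, can_move (2 ^ k) X x -> x \in s) ->
  odd_beads n X =
    \big[addb/false]_(x <- s | can_move (2 ^ k) X x) odd_beads (n - 2 ^ k) (fmove x (x - 2 ^ k) X).
Proof.
move=> Hk Us Hs; rewrite (odd_beads_fset_pow2 _ Hk) -big_filter -[RHS]big_filter.
apply: perm_big; apply: uniq_perm; rewrite ?filter_uniq ?fset_uniq // => x.
rewrite !mem_filter; apply/idP/idP => [/andP[/andP[H1 H2] H3]|/andP[/and3P[H1 H2 H3] _]].
  have Hc : can_move (2 ^ k) X x by rewrite /can_move H3 H1 H2.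
  by rewrite Hc Hs.
by rewrite H2 H3.
Qed.

(** Otherwise the bead could be moved by [h], forcing h <= m: partitions of m are h-cores for all h
    > m. *)
Lemma core_closed m h Y y : bead_size m Y -> m < h -> y \in Y -> h <= y -> y - h \in Y.
Proof.
move=> HY mh Hy hy; apply: contraLR mh => Hn; rewrite -leqNgt.
by apply: (can_move_size HY (x := y)); rewrite /can_move Hy hy.
Qed.

(** Two different moves could be carried out one after the other, which would take 2h away from
    n. *)
Lemma can_move_unique n h X x x' : bead_size n X -> 0 < h -> n < h + h ->
  can_move h X x -> can_move h X x' -> x = x'.
Proof.
move=> HX h0 Hn Hx Hx'; apply/eqP; apply: contraLR Hn => ne; rewrite -leqNgt.
have := can_move_size (bead_size_fmove HX Hx) (x := x') (h := h).
have Hhn := can_move_size HX Hx.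
suff H : can_move h (fmove x (x - h) X) x' by move=> /(_ H); lia.
case/and3P: Hx => H1 H2 H3; case/and3P: Hx' => H1' H2' H3'.
rewrite /can_move !in_fmove H1' H2' (negbTE H3') andbF orbF [x' == x]eq_sym ne orbT /=.
lia.
Qed.

Lemma top_oddE t m X x : bead_size (2 ^ t + m) X -> m < 2 ^ t -> can_move (2 ^ t) X x ->
  odd_beads (2 ^ t + m) X = odd_beads m (fmove x (x - 2 ^ t) X).
Proof.
move=> HX Hm Hx; rewrite (@odd_beads_moves t _ X [:: x]) ?leq_addr //.
  by rewrite big_cons big_nil Hx addbF addKn.
move=> x' Hx'; rewrite inE; apply/eqP; apply: (can_move_unique HX) Hx' Hx; lia.
Qed.

Lemma top_oddI t m X x : m < 2 ^ t -> can_move (2 ^ t) X x ->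
  odd_beads m (fmove x (x - 2 ^ t) X) -> odd_beads (2 ^ t + m) X.
Proof.
move=> Hm Hx Ho; rewrite (top_oddE _ Hm Hx) //.
have := odd_beads_size Ho; case/and3P: Hx => H1 H2 H3.
by rewrite /bead_size card_fmove //; have := bead_sum_fmove H1 H3; lia.
Qed.

Lemma top_oddP t m X : m < 2 ^ t -> odd_beads (2 ^ t + m) X ->
  exists Y p, [/\ odd_beads m Y, p \in Y, p + 2 ^ t \notin Y & X = fmove p (p + 2 ^ t) Y].
Proof.
move=> Hm HX; have [x Hx Ho] := odd_beads_child (leq_addr m (2 ^ t)) HX.
rewrite addKn in Ho; exists (fmove x (x - 2 ^ t) X), (x - 2 ^ t).
case/and3P: Hx => H1 H2 H3; rewrite subnK // fmoveK // !in_fmove !eqxx /= orbF.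
by split=> //; have := expn_gt0 2 t; lia.
Qed.

Lemma lift_core t m Y p : odd_beads m Y -> m < 2 ^ t -> p \in Y -> p + 2 ^ t \notin Y ->
  can_move (2 ^ t) (fmove p (p + 2 ^ t) Y) (p + 2 ^ t) /\
  odd_beads (2 ^ t + m) (fmove p (p + 2 ^ t) Y).
Proof.
move=> HY Hm Hp Hq; have Hc : can_move (2 ^ t) (fmove p (p + 2 ^ t) Y) (p + 2 ^ t).
  by rewrite /can_move !in_fmove addnK !eqxx leq_addl /=; have := expn_gt0 2 t; lia.
by split=> //; apply: (top_oddI Hm Hc); rewrite addnK fmoveK.
Qed.

(** In the 2^k-core every target is occupied. Lifting p frees only p itself, which 2^k + p can
    enter, and adds one new bead. *)
Lemma small_moves k t m Y p x : odd_beads m Y -> m < 2 ^ k -> k < t -> p + 2 ^ t \notin Y ->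
  can_move (2 ^ k) (fmove p (p + 2 ^ t) Y) x -> x \in [:: p + 2 ^ t; p + 2 ^ k].
Proof.
move=> HY mk kt Hp /and3P[]; rewrite !in_fmove !inE => /orP[->//|/andP[xp xY]] kx Hn.
apply/orP; right; have Hc := core_closed (odd_beads_size HY) mk xY kx.
by move: Hn; rewrite Hc andbT; lia.
Qed.

(* Cases: the moving bead is the lifted bead [p + 2 ^ t] of the core; or another bead of the
   core; or, when the target is the hole [p], the bead below the one that moves in the core. *)
Lemma large_move k t m Y p x : odd_beads m Y -> m < 2 ^ t -> k < t -> p \in Y -> p + 2 ^ t \notin Y ->
  2 ^ k <= m ->
  let X := fmove p (p + 2 ^ t) Y in let X' := fmove x (x - 2 ^ k) X in
  can_move (2 ^ k) X x -> odd_beads (2 ^ t + m - 2 ^ k) X' ->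
  exists y z, let Z := fmove y (y - 2 ^ k) Y in
    [/\ can_move (2 ^ k) Y y, odd_beads (m - 2 ^ k) Z, can_move (2 ^ t) X' z,
        fmove z (z - 2 ^ t) X' = Z &
        x = if y == p then p + 2 ^ t else if y == p + 2 ^ t + 2 ^ k then y - 2 ^ t else y].
Proof.
move=> HY mT kt Hp Hq km X X' Hx HX'.
have Hcore := core_closed (odd_beads_size HY).
have aT : 2 ^ k < 2 ^ t by rewrite ltn_exp2l.
have a0 : 0 < 2 ^ k by rewrite expn_gt0.
have HtX' : 2 ^ t <= 2 ^ t + m - 2 ^ k by lia.
have [z Hz] := odd_beads_child HtX' HX'.
have -> : 2 ^ t + m - 2 ^ k - 2 ^ t = m - 2 ^ k by lia.
move: Hx Hz {HX' HtX'}; rewrite /can_move {}/X' {}/X.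
move: (2 ^ k) (2 ^ t) aT a0 km mT Hq Hcore => a T aT a0 am mT Hq Hcore.
rewrite !in_fmove => /and3P[Hx ax Hxa] /and3P[Hz Tz HzT] HoZ.
have [Ex|xq] := eqVneq x (p + T).
  subst x; have Ez : z = p + T - a.
    move: Hz => /orP[/eqP //|/andP[zq /orP[/eqP Ez|/andP[zp zY]]]]; first by rewrite Ez eqxx in zq.
    have HzT' := Hcore T z mT zY Tz; move: HzT; rewrite HzT' !andbT => HzT.
    have [E|E] : z - T = p \/ z - T = p + T by lia.
      by rewrite -[z](subnK Tz) E (negbTE Hq) in zY.
    by rewrite E (negbTE Hq) in HzT'.
  have EzT : z - T = p - a by rewrite Ez subnAC addnK.
  have ap : a <= p by rewrite Ez in Tz; clear - Tz aT; lia.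
  have Hpa : p - a \notin Y.
    by move: HzT; rewrite EzT; case: (p - a \in Y) => //; lia.
  have HzY : z \notin Y by move: Hxa; rewrite -Ez; case: (z \in Y) => //; clear - Ez ap a0 aT; lia.
  have EZ : fmove z (z - T) (fmove (p + T) (p + T - a) (fmove p (p + T) Y)) = fmove p (p - a) Y.
    apply/fsetP => w; rewrite !in_fmove -Ez EzT.
    have [->|wz] := eqVneq w z; first by rewrite (negbTE HzY) !andbF.
    have [->|wq] := eqVneq w (p + T); first by rewrite (negbTE Hq) !andbF.
    by [].
  exists p, z; rewrite EZ in HoZ *; rewrite !in_fmove Hp Hpa ap eqxx Tz.
  by split=> //=; rewrite Hz HzT.
have xY : x \in Y by move: Hx => /orP[/eqP E|/andP[]//]; rewrite E eqxx in xq.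
have xp : x != p by move: Hx => /orP[/eqP E|/andP[]//]; rewrite E eqxx in xq.
have xaq : x - a != p + T by move: Hxa; rewrite negb_or => /andP[].
have Hxa' : x - a = p \/ x - a \notin Y.
  move: Hxa; rewrite negb_or (negbTE xaq) /= negb_and negbK.
  by move/orP=> [/eqP|]; [left | right].
have [Ez|zq] := eqVneq z (p + T).
  have xaY : x - a \notin Y.
    by case: Hxa' => // E; move: HzT; rewrite Ez addnK -E eqxx.
  exists x, z.
  have EZ : fmove z (z - T) (fmove x (x - a) (fmove p (p + T) Y)) = fmove x (x - a) Y.
    apply/fsetP => w; rewrite !in_fmove Ez addnK.
    have [->|wq] := eqVneq w (p + T); first by rewrite (negbTE Hq) !andbF !orbF [p + T == x - a]eq_sym (negbTE xaq); apply/negbTE; clear - aT a0; lia.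
    have [->|wp] := eqVneq w p; first by rewrite ?eqxx Hp [p == x]eq_sym xp orbT.
    by [].
  rewrite EZ in HoZ *; rewrite !in_fmove (negbTE xp) xY xaY ax Hz Tz HzT.
  by split=> //; case: eqP => // E; rewrite E addnK eqxx in xaq.
(* Since a + T > m as well, the core contains z - T in this case, and neither of the vacated
   positions p and x can be that target. *)
have [Ez|zxa] := eqVneq z (x - a).
  have HaT : x - (a + T) \in Y by apply: Hcore => //; rewrite Ez in Tz; clear - mT a0 aT Tz; lia.
  exfalso; move: HzT; rewrite Ez -subnDA HaT; rewrite Ez in Tz; clear - xaq Tz a0 aT ax; lia.
move: Hz; rewrite (negbTE zxa) (negbTE zq) /= => /and3P[zx zp zY].
have HzT' : z - T \in Y by apply: Hcore.
have EzT : z - T = x.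
  have zpT : z - T != p by apply: contraNneq zq => <-; rewrite subnK.
  by move: HzT; rewrite HzT' zpT /= orbT andbT negb_or negbK => /andP[_ /eqP].
have Exa : x - a = p.
  case: Hxa' => // H; case/negP: H; rewrite -EzT -subnDA.
  by apply: Hcore => //; rewrite -EzT in ax; clear - ax Tz mT a0; lia.
have Eza : z - a = p + T by clear - EzT Exa Tz ax; lia.
exists z, z.
have EZ : fmove z (z - T) (fmove x (x - a) (fmove p (p + T) Y)) = fmove z (z - a) Y.
  apply/fsetP => w; rewrite !in_fmove EzT Eza Exa.
  have [->|wx] := eqVneq w x; first by rewrite xY [x == z]eq_sym zx orbT.
  have [->|wp] := eqVneq w p; first by rewrite Hp [p == z]eq_sym zp ?eqxx !orbT.
  have [->|wq] := eqVneq w (p + T).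
    by rewrite ?eqxx [p + T == z]eq_sym zq ?orbT.
  by [].
rewrite EZ in HoZ *; rewrite !in_fmove Eza Hq zY (negbTE zxa) (negbTE zq) zx zp Tz HzT /=.
split=> //; [by clear - aT Tz; lia | by rewrite -Eza |].
by rewrite (negbTE zp); case: eqP => //; clear - EzT Exa Tz ax; lia.
Qed.

(** For k = t there is only one move. For m < 2^k two odd moves would exhaust [small_moves] and
    cancel in the parity sum. Otherwise [large_move] computes the move from one in the core, which
    is unique by induction. *)
Lemma odd_child_unique k n X x x' : 2 ^ k <= n -> odd_beads n X ->
  can_move (2 ^ k) X x -> odd_beads (n - 2 ^ k) (fmove x (x - 2 ^ k) X) ->
  can_move (2 ^ k) X x' -> odd_beads (n - 2 ^ k) (fmove x' (x' - 2 ^ k) X) -> x = x'.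
Proof.
have [N] := ubnP n; elim: N n X x x' => // N IH n X x x' nN kn HX Hx Ox Hx' Ox'.
have n0 : 0 < n by apply: leq_trans kn; rewrite expn_gt0.
have /andP[tn nt] := trunc_log_bounds (isT : 1 < 2) n0.
move: (trunc_log 2 n) tn nt => t tn nt.
have [m En] : exists m, n = 2 ^ t + m by exists (n - 2 ^ t); lia.
have mt : m < 2 ^ t by rewrite expnS in nt; lia.
have kt : k <= t by rewrite -ltnS -(ltn_exp2l (m := 2)) //; apply: leq_ltn_trans nt.
subst n; move: kt; rewrite leq_eqVlt => /orP[/eqP Ek|kt].
  apply: (can_move_unique (odd_beads_size HX)) Hx Hx'; rewrite Ek; lia.
have [Y [p [HY Hp Hq EX]]] := top_oddP mt HX; subst X.
have [mk|km] := ltnP m (2 ^ k).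
  apply/eqP; apply: contraT => ne.
  have Us : uniq [:: x; x'] by rewrite /= inE ne.
  have := @odd_beads_moves k _ (fmove p (p + 2 ^ t) Y) [:: x; x'] kn Us; rewrite HX !big_cons big_nil Hx Hx' Ox Ox'.
  have Px := small_moves HY mk kt Hq Hx; have Px' := small_moves HY mk kt Hq Hx'.
  move=> H; suff : true = false by []; apply: H => y /(small_moves HY mk kt Hq).
  by move: Px Px' ne; rewrite !inE; lia.
have [y [z [Hy Oy _ _ ->]]] := large_move HY mt kt Hp Hq km Hx Ox.
have [y' [z' [Hy' Oy' _ _ ->]]] := large_move HY mt kt Hp Hq km Hx' Ox'.
have mN : m < N by have := expn_gt0 2 t; clear - nN; lia.
by rewrite (IH m Y y y' mN km HY Hy Oy Hy' Oy').
Qed.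

Definition hook_step k n X X' :=
  exists2 x, can_move (2 ^ k) X x & X' = fmove x (x - 2 ^ k) X /\ odd_beads (n - 2 ^ k) X'.

Lemma hook_step_exists k n X : 2 ^ k <= n -> odd_beads n X -> exists X', hook_step k n X X'.
Proof.
move=> Hk HX; have [x Hx Ox] := odd_beads_child Hk HX.
by exists (fmove x (x - 2 ^ k) X), x.
Qed.

Lemma hook_step_unique k n X A A' : 2 ^ k <= n -> odd_beads n X ->
  hook_step k n X A -> hook_step k n X A' -> A = A'.
Proof.
move=> Hk HX [x Hx [-> Ox]] [x' Hx' [-> Ox']].
by rewrite (odd_child_unique Hk HX Hx Ox Hx' Ox').
Qed.

Lemma hook_step_odd k n X A : hook_step k n X A -> odd_beads (n - 2 ^ k) A.
Proof. by case=> x _ []. Qed.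

Lemma f_hook_step N n k la : size la <= N -> odd_partition n la -> 2 ^ k <= n ->
  [/\ odd_partition (n - 2 ^ k) (f n k la), size (f n k la) <= N &
      hook_step k n (bead_set N la) (bead_set N (f n k la))].
Proof.
move=> HN Hla Hk; have [Ho Hsz [x Hx E]] := f_spec HN Hla Hk; split=> //.
exists x => //; split=> //; move: Ho; rewrite (odd_partition_bead_set _ Hsz).
by case/andP.
Qed.

(** Partitions correspond to bead sets and odd children are unique, so [hook_step] is the graph of
    [f], and any two chains of steps may be compared. *)
Lemma f_commuteP n k l : 2 ^ k + 2 ^ l <= n -> f_commute n k l <->
  forall X A B C D, odd_beads n X -> hook_step l n X A -> hook_step k (n - 2 ^ l) A C ->
    hook_step k n X B -> hook_step l (n - 2 ^ k) B D -> C = D.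
Proof.
move=> Hn; have Hk : 2 ^ k <= n by lia.
have Hl : 2 ^ l <= n by lia.
have Hkl : 2 ^ k <= n - 2 ^ l by lia.
have Hlk : 2 ^ l <= n - 2 ^ k by lia.
split=> [Hf X A B C D HX HA HC HB HD|Hf la Hla].
  have [la Hp [HN EX]] := bead_set_surj (odd_beads_size HX).
  set N := #|` X|%fset in HN EX.
  have Hla : odd_partition n la by rewrite (odd_partition_bead_set _ HN) Hp EX.
  have [Oa Na Sa] := f_hook_step HN Hla Hl.
  have [Oc Nc Sc] := f_hook_step Na Oa Hkl.
  have [Ob Nb Sb] := f_hook_step HN Hla Hk.
  have [Od Nd Sd] := f_hook_step Nb Ob Hlk.
  rewrite EX in Sa Sb.
  have EA := hook_step_unique Hl HX HA Sa; have EB := hook_step_unique Hk HX HB Sb.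
  rewrite -EA in Sc; rewrite -EB in Sd.
  rewrite (hook_step_unique Hkl (hook_step_odd HA) HC Sc).
  by rewrite (hook_step_unique Hlk (hook_step_odd HB) HD Sd) (Hf la Hla).
have HN := leqnn (size la).
have [Oa Na Sa] := f_hook_step HN Hla Hl.
have [Oc Nc Sc] := f_hook_step Na Oa Hkl.
have [Ob Nb Sb] := f_hook_step HN Hla Hk.
have [Od Nd Sd] := f_hook_step Nb Ob Hlk.
have HX : odd_beads n (bead_set (size la) la).
  by move: Hla; rewrite (odd_partition_bead_set _ HN) => /andP[].
have E := Hf _ _ _ _ _ HX Sa Sc Sb Sd.
move: Oc Od; rewrite /odd_partition => /andP[Pc _] /andP[Pd _].
apply: (bead_set_inj Pc) Nc Nd E; move: Pd.
by rewrite -!subnDA addnC.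
Qed.

(** The step by 2^t first leads to the core; [large_move] provides the later 2^t-move that closes
    the square. *)
Lemma f_commute_top n t m k : n = 2 ^ t + m -> m < 2 ^ t -> k < t -> 2 ^ k + 2 ^ t <= n ->
  f_commute n k t.
Proof.
move=> En mt kt Hn; apply/(f_commuteP Hn) => X A B C D HX HA HC HB HD; subst n.
have km : 2 ^ k <= m by lia.
have [Y [p [HY Hp Hq EX]]] := top_oddP mt HX; subst X.
have [Hc Oc] := lift_core HY mt Hp Hq.
have EA : A = Y.
  apply: (hook_step_unique (leq_addr _ _) HX HA); exists (p + 2 ^ t) => //.
  by rewrite addnK fmoveK // addKn.
case: HB => x Hx [EB OB]; rewrite EB in OB.
have [y [z [Hy Oy Hz Ez _]]] := large_move HY mt kt Hp Hq km Hx OB.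
have SD : hook_step t (2 ^ t + m - 2 ^ k) B (fmove y (y - 2 ^ k) Y).
  by exists z; rewrite EB // Ez; split=> //; rewrite subnAC addKn.
have SC : hook_step k (2 ^ t + m - 2 ^ t) A (fmove y (y - 2 ^ k) Y).
  by exists y; rewrite EA // addKn.
rewrite -EB in OB; have H1 : 2 ^ t <= 2 ^ t + m - 2 ^ k by clear - km; lia.
rewrite (hook_step_unique H1 OB HD SD).
by apply: hook_step_unique (hook_step_odd HA) HC SC; rewrite addKn.
Qed.

End Steps.

(** * Hooks in the quotient of a core *)

Section SmallRemainder.
Implicit Types (Y : {fset nat}) (a b g h j k l m n p q s t x : nat).

(** This is (1 + x)^2 = 1 + x^2 modulo 2. *)
Lemma odd_bin2 n j : odd 'C(n.+2, j.+2) = odd 'C(n, j) (+) odd 'C(n, j.+2).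
Proof. by rewrite !binS !oddD; do 3!case: odd. Qed.

Lemma odd_bin_half n j :
  odd 'C(n, j) = (odd j ==> odd n) && odd 'C(n./2, j./2).
Proof.
have [M] := ubnP n; elim: M n j => // M IH n j nM.
case: j => [|[|j]]; first by rewrite !bin0.
  by rewrite bin1 /= bin0 andbT; case: odd.
case: n nM => [|[|n]] nM; first by rewrite !bin0n /= andbF.
  by rewrite bin_small // bin0n andbF.
have {}nM : n < M by lia.
rewrite odd_bin2 (IH n j nM) (IH n j.+2 nM) /= binS oddD !negbK.
by case: (_ ==> _); rewrite //= addbC.
Qed.

(** Lucas: an odd binomial coefficient has a digit 0 below wherever it has one above. *)
Lemma odd_bin_bit b n j : odd 'C(n, j) -> ~~ odd (n %/ 2 ^ b) -> ~~ odd (j %/ 2 ^ b).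
Proof.
elim: b n j => [|b IH] n j; rewrite odd_bin_half => /andP[H1 H2].
  by rewrite expn0 !divn1; case: odd H1 => //= ->.
by rewrite expnS !divnMA !divn2; apply: IH.
Qed.

(** On the runner upwards from q exactly [g] beads follow without a gap. A bead lifted from q beyond
    them jumps over [g] beads, the leg length in the quotient. *)
Definition ladder a Y q g := forall j, (q + a * j \in Y) = (j <= g).

(* In the 2^k-quotient the lifted bead is a hook of size h and leg length g. *)
Lemma odd_hook k m Y q g h : odd_beads m Y -> m < 2 ^ k -> ladder (2 ^ k) Y q g -> g < h ->
  odd_beads (2 ^ k * h + m) (fmove q (q + 2 ^ k * h) Y) = odd 'C(h.-1, g).
Proof.
move=> HY mk; elim: h q g => // h IH q g Hl gh.
have a0 : 0 < 2 ^ k by rewrite expn_gt0.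
have Hq : q \in Y by have := Hl 0; rewrite muln0 addn0.
have Hqh : q + 2 ^ k * h.+1 \notin Y by rewrite Hl -ltnNge.
have Hn : 2 ^ k <= 2 ^ k * h.+1 + m by rewrite mulnS -addnA leq_addr.
have Hmv x : can_move (2 ^ k) (fmove q (q + 2 ^ k * h.+1) Y) x ->
    x \in [:: q + 2 ^ k * h.+1; q + 2 ^ k].
  move=> /and3P[]; rewrite !in_fmove !inE => /orP[->//|/andP[xq xY]] kx Hx.
  apply/orP; right; have Hc := core_closed (odd_beads_size HY) mk xY kx.
  by move: Hx; rewrite Hc andbT; clear - kx; lia.
case: h IH gh Hqh Hn Hmv => [|h] IH gh Hqh Hn Hmv.
  move: gh; rewrite ltnS leqn0 => /eqP g0; rewrite g0 bin0 muln1 in Hqh Hn Hmv *.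
  rewrite (@odd_beads_moves k _ _ [:: q + 2 ^ k]) //; last first.
    by move=> x /Hmv; rewrite !inE orbb.
  rewrite big_cons big_nil /can_move !in_fmove addnK eqxx leq_addl /= !eqxx /= orbF addKn fmoveK // HY.
  by rewrite ltn_eqF // -[X in X < _]addn0 ltn_add2l.
set X := fmove _ _ _.
have Us : uniq [:: q + 2 ^ k * h.+2; q + 2 ^ k].
  by rewrite /= inE andbT eqn_add2l mulnS -[X in _ != X]addn0 eqn_add2l mulnS addn_eq0 negb_and -lt0n a0.
rewrite (odd_beads_moves Hn Us Hmv) !big_cons big_nil.
have -> : 2 ^ k * h.+2 + m - 2 ^ k = 2 ^ k * h.+1 + m by rewrite mulnS -addnA addKn.
have E1 : q + 2 ^ k * h.+2 - 2 ^ k = q + 2 ^ k * h.+1 by rewrite mulnS addnCA addKn.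
have E2 : q + 2 ^ k * h.+2 = q + 2 ^ k + 2 ^ k * h.+1 by rewrite mulnS addnA.
have n12 : (q + 2 ^ k * h.+1 == q + 2 ^ k * h.+2) = false.
  by rewrite ltn_eqF // ltn_add2l ltn_pmul2l.
have n1q : (q + 2 ^ k * h.+1 == q) = false.
  by rewrite gtn_eqF // -[X in X < _]addn0 ltn_add2l muln_gt0 a0.
have nq2 : (q == q + 2 ^ k * h.+2) = false.
  by rewrite ltn_eqF // -[X in X < _]addn0 ltn_add2l muln_gt0 a0.
have naq : (q == q + 2 ^ k) = false.
  by rewrite ltn_eqF // -[X in X < _]addn0 ltn_add2l.
have na2 : (q + 2 ^ k == q + 2 ^ k * h.+2) = false.
  by move: Us; rewrite /= inE andbT eq_sym => /negbTE.
have la2 : 2 ^ k <= q + 2 ^ k * h.+2 by rewrite mulnS addnCA leq_addr.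
have M1 : can_move (2 ^ k) X (q + 2 ^ k * h.+2) = (g <= h).
  by rewrite /can_move /X !in_fmove E1 n12 n1q eqxx la2 !Hl /= -leqNgt.
have M2 : can_move (2 ^ k) X (q + 2 ^ k) = (0 < g).
  have := Hl 1; rewrite muln1 => Hl1.
  by rewrite /can_move /X !in_fmove addnK leq_addl Hl1 na2 nq2 [_ == q]eq_sym naq eqxx /= andbT.
(* Pascal's rule: either the lifted bead comes down one rung and the leg stays, or the next rung
   fills the hole q, which moves the hole up and shortens the leg by one. *)
have F1 : fmove (q + 2 ^ k * h.+2) (q + 2 ^ k * h.+1) X = fmove q (q + 2 ^ k * h.+1) Y.
  apply/fsetP => w; rewrite !in_fmove.
  by have [->|w2] := eqVneq w (q + 2 ^ k * h.+2); rewrite ?(negbTE Hqh) ?andbF.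
have F2 : fmove (q + 2 ^ k) q X = fmove (q + 2 ^ k) (q + 2 ^ k + 2 ^ k * h.+1) Y.
  rewrite -E2; apply/fsetP => w; rewrite !in_fmove.
  have [->|wq] := eqVneq w q; first by rewrite naq Hq orbT.
  have [->|w2] := eqVneq w (q + 2 ^ k * h.+2) => //.
  by rewrite [_ == q + 2 ^ k]eq_sym na2.
rewrite M1 M2 E1 F1 addnK.
case: g Hl gh M1 M2 => [|g] Hl gh M1 M2.
  by rewrite /= (IH q 0) // !bin0.
rewrite /= F2 (IH (q + 2 ^ k) g) => [|j|]; last 2 first.
- by rewrite -addnA -mulnS Hl.
- by [].
rewrite binS oddD addbF; case: ltnP => gh'; first by rewrite (IH q g.+1) // addbC.
by rewrite (@bin_small h g.+1).
Qed.

(** A state is a core with one bead lifted. Either the lifted bead descends ([e] false), or q + d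
    falls into the hole and becomes the new hole below an unchanged lifted bead ([e] true). *)
Lemma hook_state_move d H Y q x : 0 < d -> d < H -> q \in Y -> q + H \notin Y ->
  (forall y, y \in Y -> d <= y -> y - d \in Y) -> can_move d (fmove q (q + H) Y) x ->
  exists e : bool, let q' := q + e * d in
    [/\ q' \in Y, q' + (H - d) \notin Y &
       fmove x (x - d) (fmove q (q + H) Y) = fmove q' (q' + (H - d)) Y].
Proof.
move=> d0 dH Hq HqH Hc /and3P[]; rewrite !in_fmove.
have EH : q + H - d = q + (H - d) by clear - dH; lia.
have nqH : (q == q + H) = false by clear - d0 dH; lia.
have [-> _ _|xqH /= /andP[xq xY] dx] := eqVneq x (q + H).
  rewrite EH negb_or => /andP[nE].
  have -> : (q + (H - d) == q) = false by clear - dH; lia.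
  move=> /= HY'; exists false; rewrite mul0n addn0; split=> //.
  apply/fsetP => w; rewrite !in_fmove.
  by have [->|w2] := eqVneq w (q + H); rewrite ?(negbTE HqH) ?andbF.
rewrite (Hc x xY dx) andbT negb_or negbK => /andP[_ /eqP Ex].
exists true; rewrite mul1n -Ex subnK // xY.
have E2 : x + (H - d) = q + H by clear - Ex dx dH; lia.
rewrite Ex E2; split=> //; apply/fsetP => w; rewrite !in_fmove.
have [->|wq] := eqVneq w q; first by rewrite [q == x]eq_sym xq Hq orbT.
have [->|w2] := eqVneq w (q + H) => //=.
by rewrite [_ == x]eq_sym xqH.
Qed.

Lemma ladder_exists a H Y q : q + a * H \notin Y -> q \in Y ->
  (forall y, y \in Y -> a <= y -> y - a \in Y) -> exists g, ladder a Y q g.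
Proof.
move=> HH Hq Hc.
have exP : exists j, q + a * j \notin Y by exists H.
case: (ex_minnP exP) => -[|g] Hg Hm; first by rewrite muln0 addn0 Hq in Hg.
exists g => j; have [jg|gj] := leqP j g.
  by apply: contraT => /Hm; rewrite ltnNge jg.
apply/negbTE; elim: j gj => // j IH; rewrite ltnS leq_eqVlt => /orP[/eqP <- //|/IH].
apply: contra => HY'; have := Hc _ HY'.
by rewrite mulnS addnCA addKn leq_addr; apply.
Qed.

(** The upper index has digit 0 at positions 0 and b, hence so has the lower one. This forces e to
    be digit 0 of [G] and e' to be digit b of G - e, whatever the order of the moves. *)
Lemma pow2_bit_binomial s b G (e1 e2 e1' e2' : bool) : 0 < b -> b < s ->
  e1 + e1' * 2 ^ b <= G -> e2 + e2' * 2 ^ b <= G ->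
  odd 'C(2 ^ s - 2 - 2 ^ b, G - (e1 + e1' * 2 ^ b)) ->
  odd 'C(2 ^ s - 2 - 2 ^ b, G - (e2 + e2' * 2 ^ b)) -> e1 = e2 /\ e1' = e2'.
Proof.
move=> b0 bs.
have b2 : 2 ^ b = (2 ^ b.-1).*2 by rewrite -mul2n -expnS prednK.
have sb2 : 2 ^ (s - b) = (2 ^ (s - b).-1).*2 by rewrite -mul2n -expnS prednK ?subn_gt0.
have Es : 2 ^ s = 2 ^ b * 2 ^ (s - b) by rewrite -expnD subnKC // ltnW.
have c0 : 0 < 2 ^ b.-1 by rewrite expn_gt0.
have d0 : 0 < 2 ^ (s - b).-1 by rewrite expn_gt0.
set n := 2 ^ s - 2 - 2 ^ b.
have n0 : ~~ odd n.
  have -> : n = (2 ^ b.-1 * 2 ^ (s - b) - 1 - 2 ^ b.-1).*2.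
    by rewrite !doubleB doubleMl -b2 -Es.
  by rewrite odd_double.
have nb : ~~ odd (n %/ 2 ^ b).
  have -> : n = (2 ^ (s - b) - 2) * 2 ^ b + (2 ^ b - 2).
    have: 2 * 2 ^ b <= 2 ^ (s - b) * 2 ^ b by rewrite leq_mul2r sb2 -[2]/(1.*2) leq_double d0 orbT.
    rewrite /n Es mulnBl [_ * 2 ^ (s - b)]mulnC.
    by move: (2 ^ (s - b) * _) => Q; move: b2 c0; clear; lia.
  rewrite divnMDl ?expn_gt0 // divn_small ?addn0; last first.
    by rewrite -{2}[2 ^ b]subn0 ltn_sub2l ?expn_gt0.
  by rewrite sb2 -[X in _ - X]/(1.*2) -doubleB odd_double.
have key (e e' : bool) : e + e' * 2 ^ b <= G -> odd 'C(n, G - (e + e' * 2 ^ b)) ->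
    odd G = e /\ odd ((G - e) %/ 2 ^ b) = e'.
  move=> He Ho; have := odd_bin_bit (b := 0) Ho; rewrite expn0 !divn1 => /(_ n0) H0.
  have := odd_bin_bit (b := b) Ho nb => Hb; split.
    move: H0; rewrite oddB // oddD oddM b2 odd_double andbF addbF oddb negb_add.
    by move/eqP.
  have EG : G - e = e' * 2 ^ b + (G - (e + e' * 2 ^ b)).
    by rewrite addnC subnDA subnK // leq_subRL // (leq_trans (leq_addr _ _) He).
  by rewrite EG divnMDl ?expn_gt0 // oddD (negbTE Hb) addbF oddb.
move=> H1 H2 /(key _ _ H1)[E1 E1'] /(key _ _ H2)[E2 E2'].
by rewrite -E1 E2 -E1' -E2' -E1 E2.
Qed.

Lemma core_closed_mul m Y d : odd_beads m Y -> m < d ->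
  forall y, y \in Y -> d <= y -> y - d \in Y.
Proof. by move=> HY md y; apply: core_closed (odd_beads_size HY) md. Qed.

Lemma f_commute_small n t m k l : n = 2 ^ t + m -> m < 2 ^ k -> k < l -> l < t ->
  f_commute n k l.
Proof.
move=> En mk kl lt.
have kl2 : 2 ^ k < 2 ^ l by rewrite ltn_exp2l.
have lt2 : 2 ^ l + 2 ^ l <= 2 ^ t by rewrite addnn -mul2n -expnS leq_exp2l.
have k0 : 0 < 2 ^ k by rewrite expn_gt0.
have l0 : 0 < 2 ^ l by rewrite expn_gt0.
have Hn : 2 ^ k + 2 ^ l <= n by clear - En kl2 lt2; lia.
apply/(f_commuteP Hn) => X A B C D HX [x Hx [-> _]] [y Hy [-> OC]] [x' Hx' [-> _]] [y' Hy' [-> OD]].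
subst n; have mt : m < 2 ^ t by clear - mk kl2 lt2; lia.
have ml : m < 2 ^ l by clear - mk kl2; lia.
have [Y [p [HY Hp Hq EX]]] := top_oddP mt HX; subst X.
have Ck := core_closed_mul HY mk; have Cl := core_closed_mul HY ml.
have kt2 : 2 ^ k < 2 ^ t by clear - kl2 lt2; lia.
have lt2' : 2 ^ l < 2 ^ t by clear - l0 lt2; lia.
have klt : 2 ^ k < 2 ^ t - 2 ^ l by clear - kl2 lt2; lia.
have lkt : 2 ^ l < 2 ^ t - 2 ^ k by clear - kl2 lt2; lia.
have [e1 /= [P1 N1 E1]] := hook_state_move l0 lt2' Hp Hq Cl Hx.
rewrite E1 in Hy OC *.
have [e2 /= [P2 N2 E2]] := hook_state_move k0 klt P1 N1 Ck Hy.
rewrite E2 in OC *.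
have [e3 /= [P3 N3 E3]] := hook_state_move k0 kt2 Hp Hq Ck Hx'.
rewrite E3 in Hy' OD *.
have [e4 /= [P4 N4 E4]] := hook_state_move l0 lkt P3 N3 Cl Hy'.
rewrite E4 in OD *.
pose s := t - k; pose b := l - k.
have Et : 2 ^ t = 2 ^ k * 2 ^ s by rewrite -expnD subnKC //; clear - kl lt; lia.
have El : 2 ^ l = 2 ^ k * 2 ^ b by rewrite -expnD subnKC //; clear - kl; lia.
have b0 : 0 < b by clear - kl; lia.
have bs : b < s by clear - kl lt; lia.
have sb2 : 2 ^ b + 2 ^ b <= 2 ^ s by rewrite addnn -mul2n -expnS leq_exp2l.
have b2 : 2 <= 2 ^ b by rewrite -[2]/(2 ^ 1) leq_exp2l.
(* Both orders end with a lift by 2^k * h. The hole has climbed c rungs, with c = e2 + e1 * 2^b or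
   e3 + e4 * 2^b, so the leg is G - c and the parity that of a binomial coefficient over h - 1. *)
pose h := 2 ^ s - 1 - 2 ^ b.
have Eh : 2 ^ t - 2 ^ l - 2 ^ k = 2 ^ k * h by rewrite Et El /h !mulnBr muln1 subnAC.
have Eh' : 2 ^ t - 2 ^ k - 2 ^ l = 2 ^ k * h by rewrite subnAC.
rewrite Eh in N2 OC *; rewrite Eh' in N4 OD *.
have [G HG] : exists G, ladder (2 ^ k) Y p G.
  by apply: (@ladder_exists (2 ^ k) (2 ^ s)); rewrite -?Et.
have Q2 : p + e1 * 2 ^ l + e2 * 2 ^ k = p + 2 ^ k * (e2 + e1 * 2 ^ b).
  by rewrite El mulnDr mulnCA [e2 * _]mulnC -addnA [X in p + X]addnC.
have Q4 : p + e3 * 2 ^ k + e4 * 2 ^ l = p + 2 ^ k * (e3 + e4 * 2 ^ b).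
  by rewrite El mulnDr mulnCA [e3 * _]mulnC -addnA.
rewrite Q2 in P2 N2 OC *; rewrite Q4 in P4 N4 OD *.
have hook_odd (c : nat) : p + 2 ^ k * c \in Y -> p + 2 ^ k * c + 2 ^ k * h \notin Y ->
    odd_beads (2 ^ k * h + m) (fmove (p + 2 ^ k * c) (p + 2 ^ k * c + 2 ^ k * h) Y) ->
    c <= G /\ odd 'C(2 ^ s - 2 - 2 ^ b, G - c).
  rewrite HG => cG; rewrite -addnA -mulnDr HG -ltnNge => Gh Ho; split=> //.
  have Hl : ladder (2 ^ k) Y (p + 2 ^ k * c) (G - c).
    by move=> j; rewrite -addnA -mulnDr HG; clear - cG; lia.
  have hG : G - c < h by clear - cG Gh; lia.
  have := odd_hook HY mk Hl hG; rewrite -addnA -mulnDr Ho => /esym.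
  by have -> : h.-1 = 2 ^ s - 2 - 2 ^ b by rewrite /h; clear; lia.
have nE : 2 ^ t + m - 2 ^ l - 2 ^ k = 2 ^ k * h + m by rewrite -Eh; clear - kl2 lt2; lia.
have nE' : 2 ^ t + m - 2 ^ k - 2 ^ l = 2 ^ k * h + m by rewrite -Eh; clear - kl2 lt2; lia.
rewrite nE in OC; rewrite nE' in OD.
have [c1 o1] := hook_odd _ P2 N2 OC; have [c2 o2] := hook_odd _ P4 N4 OD.
by have [-> ->] := pow2_bit_binomial b0 bs c1 c2 o1 o2.
Qed.

End SmallRemainder.

(** * Partitions on which the maps do not commute *)

Section Counterexamples.
Implicit Types (X Y R : {fset nat}) (j k l m n t r u v w x y z N : nat).

(** The bead set of the one-row partition (m) with j + 1 beads: in every step only the top bead can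
    move. *)
Lemma row_odd m j R : (forall z, (z \in R) = (z < j) || (z == j + m)) -> odd_beads m R.
Proof.
elim: m R => [|m IH] R HR.
  have HR' : perm_eq R (iota 0 j.+1).
    apply: uniq_perm; rewrite ?fset_uniq ?iota_uniq // => z.
    by rewrite HR mem_iota addn0 add0n /= [RHS]ltnS [RHS]leq_eqVlt orbC.
  rewrite /= fset_uniq (perm_size HR') size_iota /=; apply/allP => z.
  by rewrite (perm_mem HR') mem_iota.
rewrite (@odd_beads_moves 0 _ R [:: j + m.+1]) //= => [|x].
  rewrite big_cons big_nil /can_move !HR expn0 !subn1 eqxx orbT addbF.
  rewrite addnS /= ltnNge leq_addr /= ltn_eqF //.
  apply: IH => z; rewrite in_fmove HR addnS.
  have [->|zj] := eqVneq z (j + m).+1; last by rewrite /= orbF orbC.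
  by rewrite /= orbF [_ < j]ltnNge leqW ?leq_addr.
rewrite /can_move !HR inE expn0 subn1 => /and3P[/orP[xj|//] x0].
by rewrite (leq_ltn_trans (leq_pred x) xj).
Qed.

Lemma fmoveC x y x' y' X : x != y' -> x' != y ->
  fmove x y (fmove x' y' X) = fmove x' y' (fmove x y X).
Proof.
move=> xy' x'y; apply/fsetP => z; rewrite !in_fmove.
have [->|zy] := eqVneq z y; first by rewrite [y == x']eq_sym x'y orbT.
by have [->|zy'] := eqVneq z y'; rewrite ?[y' == x]eq_sym ?xy' //= andbCA.
Qed.

Lemma fmove_fmove x y w X : y \in X -> x != y -> x != w -> fmove x y (fmove y w X) = fmove x w X.
Proof.
move=> Hy xy xw; apply/fsetP => z; rewrite !in_fmove.
have [->|zy] := eqVneq z y; first by rewrite [y == x]eq_sym xy Hy orbT.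
by have [->|zw] := eqVneq z w; rewrite //= [w == x]eq_sym xw.
Qed.

(** Common shape of all witnesses: a block of beads above position 0 and two further beads. If u or
    v is 0, the hole at 0 is filled and a one-row partition may arise. *)
Definition pset N u v : {fset nat} := [fset x in iota 1 N.-1 ++ [:: u; v]]%fset.

Lemma in_pset N u v z : (z \in pset N u v) = [|| 0 < z < N, z == u | z == v].
Proof.
rewrite in_fset /= mem_cat mem_iota !inE; congr (_ || _).
by clear; lia.
Qed.

Lemma psetC N u v : pset N u v = pset N v u.
Proof. by apply/fsetP => z; rewrite !in_pset [(z == u) || _]orbC. Qed.

Lemma fmove_pset N u v y : N <= u -> u != v -> fmove u y (pset N u v) = pset N y v.
Proof.
move=> Nu uv; apply/fsetP => z; rewrite in_fmove !in_pset [RHS]orbCA; congr (_ || _).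
have [->|_] := eqVneq z u; last by [].
by rewrite (negbTE uv) orbF [u < N]ltnNge Nu andbF.
Qed.

Lemma notin_pset N u v y : (y == 0) || (N <= y) -> y != u -> y != v -> y \notin pset N u v.
Proof.
move=> Hy yu yv; rewrite in_pset (negbTE yu) (negbTE yv) !orbF negb_and -!leqNgt leqn0.
exact: Hy.
Qed.

Lemma row_pset m N v : 0 < N -> v = N + m -> odd_beads m (pset N 0 v).
Proof.
by move=> N0 ->; apply: (@row_odd _ N) => z; rewrite in_pset orbA; case: z => [|z]; rewrite ?N0 ?orbF.
Qed.

Lemma top_pset t m N v : m < 2 ^ t -> 0 < N -> N <= 2 ^ t -> v = N + m -> v != 2 ^ t ->
  odd_beads (2 ^ t + m) (pset N (2 ^ t) v).
Proof.
move=> mt N0 NT Ev vT; apply: (@top_oddI t m _ (2 ^ t) mt).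
  rewrite /can_move subnn leqnn in_pset eqxx orbT /=.
  by apply: notin_pset; rewrite ?eqxx // eq_sym ?Ev -lt0n ?expn_gt0 // ltn_addr.
by rewrite subnn fmove_pset // 1?eq_sym //; apply: row_pset.
Qed.

Lemma hook_step_fmove k n X x y : x = y + 2 ^ k -> x \in X -> y \notin X ->
  odd_beads (n - 2 ^ k) (fmove x y X) -> hook_step k n X (fmove x y X).
Proof.
move=> Ex Hx Hy Ho; have Ey : x - 2 ^ k = y by rewrite Ex addnK.
by exists x; rewrite ?Ey // /can_move Hx Ey Hy Ex leq_addl.
Qed.

Lemma hook_step_pset k n N u v y : u = y + 2 ^ k -> N <= u -> u != v ->
  (y == 0) || (N <= y) -> y != v -> odd_beads (n - 2 ^ k) (pset N y v) ->
  hook_step k n (pset N u v) (pset N y v).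
Proof.
move=> Eu Nu uv Hy yv Ho; rewrite -(fmove_pset y Nu uv) in Ho *.
apply: hook_step_fmove => //; first by rewrite in_pset eqxx orbT.
apply: notin_pset => //; rewrite Eu -[X in X != _]addn0 eqn_add2l eq_sym.
by rewrite -lt0n expn_gt0.
Qed.

Lemma not_commuteI n k l X A B C D : 2 ^ k + 2 ^ l <= n -> odd_beads n X ->
  hook_step l n X A -> hook_step k (n - 2 ^ l) A C ->
  hook_step k n X B -> hook_step l (n - 2 ^ k) B D -> C != D -> ~ f_commute n k l.
Proof.
move=> Hn HX HA HC HB HD CD /(f_commuteP Hn) H.
by case/eqP: CD; apply: H HX HA HC HB HD.
Qed.

Lemma neq_fset X Y z : (z \in X) != (z \in Y) -> X != Y.
Proof. by apply: contraNneq => ->. Qed.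

(* In the next two lemmas the witness is the one-row core (m), written with N beads, whose
   bead 0 is lifted to 2^t; N is chosen so that the row's own bead m + N is at 2^t + 2^k,
   respectively at 2^l. *)
Lemma not_commute_large t m k l : m < 2 ^ t -> k < l -> l < t -> 2 ^ k + 2 ^ l <= m ->
  ~ f_commute (2 ^ t + m) k l.
Proof.
move=> mT kl lt klm.
have aL : 2 ^ k < 2 ^ l by rewrite ltn_exp2l.
have LT : 2 ^ l < 2 ^ t by rewrite ltn_exp2l.
have a0 : 0 < 2 ^ k by rewrite expn_gt0.
have Hn : 2 ^ k + 2 ^ l <= 2 ^ t + m by clear - klm; lia.
have eA : 2 ^ t + m - 2 ^ l = 2 ^ t + (m - 2 ^ l) by clear - klm; lia.
have eC : 2 ^ t + m - 2 ^ l - 2 ^ k = 2 ^ t + (m - 2 ^ l - 2 ^ k) by clear - klm; lia.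
have eB : 2 ^ t + m - 2 ^ k = 2 ^ t + (m - 2 ^ k) by clear - klm; lia.
have eD : 2 ^ t + m - 2 ^ k - 2 ^ l = 2 ^ t + (m - 2 ^ k - 2 ^ l) by clear - klm; lia.
have [u ET] : exists u, 2 ^ t = u + 2 ^ l by exists (2 ^ t - 2 ^ l); rewrite subnK // ltnW.
have [N EN] : exists N, N + m = 2 ^ t + 2 ^ k.
  by exists (2 ^ t + 2 ^ k - m); rewrite subnK // ltnW // ltn_addr.
have aN : 2 ^ k < N by clear - EN mT; lia.
have Nu : N <= u by clear - EN ET klm; lia.
have uT : u < 2 ^ t by clear - ET aL; lia.
have NT : N <= 2 ^ t by apply: leq_trans Nu (ltnW uT).
have N0 : 0 < N by apply: leq_ltn_trans aN.
(* The bead 2^t blocks the 2^k-move of 2^t + 2^k, so f_k moves 2^k into the hole 0. Once f_l has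
   lowered 2^t + 2^k, the block is gone and f_k continues with that bead. *)
pose X := pset N (2 ^ t) (2 ^ t + 2 ^ k).
have aX : 2 ^ k \in X by rewrite in_pset a0 aN.
have nX : 0 \notin X by apply: notin_pset => //; clear - a0 LT; lia.
have Ta : 2 ^ t + 2 ^ k != 2 ^ t by clear - a0; lia.
have neqs : [/\ 2 ^ t + 2 ^ k != u + 2 ^ k, 2 ^ t != u + 2 ^ k, 2 ^ t != u & u != 2 ^ t + 2 ^ k].
  by clear - ET aL a0; split; lia.
case: neqs => n1 n2 n3 n4.
(* With 2^k moved to 0, the bead 2^t + 2^k can fall by 2^t into the place left free, and a one-row
   partition remains. *)
have topB v m' : m' < 2 ^ t -> v = N + m' -> 2 ^ t + 2 ^ k != v ->
   odd_beads (2 ^ t + m') (fmove (2 ^ k) 0 (pset N v (2 ^ t + 2 ^ k))).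
  move=> m'T Ev vq; apply: (@top_oddI t _ _ (2 ^ t + 2 ^ k) m'T).
    rewrite /can_move addKn leq_addr !in_fmove in_pset !eqxx !orbT andbT /=.
    by clear - a0 LT; lia.
  rewrite addKn fmove_fmove ?in_pset ?a0 ?aN //; [|clear - LT; lia..].
  by rewrite psetC fmove_pset // ?(leq_trans NT) ?leq_addr //; apply: row_pset.
have mb : m - 2 ^ k < 2 ^ t by apply: leq_ltn_trans (leq_subr _ _) mT.
have md : m - 2 ^ k - 2 ^ l < 2 ^ t by apply: leq_ltn_trans (leq_subr _ _) mb.
apply: (@not_commuteI _ k l X (pset N (u + 2 ^ k) (2 ^ t)) (fmove (2 ^ k) 0 X)
          (pset N u (2 ^ t)) (fmove (2 ^ k) 0 (pset N u (2 ^ t + 2 ^ k))) Hn).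
- by apply: top_pset.
- rewrite /X psetC; apply: hook_step_pset => //.
  + by clear - ET; lia.
  + by apply: leq_trans NT (leq_addr _ _).
  + by rewrite (leq_trans Nu) ?orbT ?leq_addr.
  + by rewrite eq_sym.
  rewrite eA psetC; apply: top_pset => //; [|by clear - EN ET klm; lia|by rewrite eq_sym].
  by apply: leq_ltn_trans (leq_subr _ _) mT.
- apply: hook_step_pset => //.
  + by rewrite (leq_trans Nu) ?leq_addr.
  + by rewrite eq_sym.
  + by rewrite Nu orbT.
  + by rewrite eq_sym.
  rewrite eC psetC; apply: top_pset => //; [|by clear - EN ET klm; lia|by rewrite eq_sym].
  by rewrite subnAC.
- apply: hook_step_fmove => //; rewrite eB /X; apply: topB => //.
  by clear - EN klm; lia.
- have <- : fmove (2 ^ t) u (fmove (2 ^ k) 0 X) = fmove (2 ^ k) 0 (pset N u (2 ^ t + 2 ^ k)).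
    rewrite fmoveC ?fmove_pset // 1?eq_sym //; first by clear - LT; lia.
    by clear - aN Nu; lia.
  apply: hook_step_fmove => //.
  + rewrite in_fmove in_pset eqxx !orbT andbT; clear - aL LT; lia.
  + rewrite in_fmove [u \in X]negbTE ?andbF ?orbF; first by clear - aN Nu; lia.
    by apply: notin_pset; rewrite ?Nu ?orbT // eq_sym.
  rewrite eD fmoveC ?fmove_pset // 1?eq_sym //; [|clear - LT; lia|clear - aN Nu; lia].
  by apply: topB => //; clear - EN ET klm; lia.
apply: (@neq_fset _ _ (2 ^ t + 2 ^ k)).
have qN : (2 ^ t + 2 ^ k < N) = false by rewrite ltnNge (leq_trans NT) ?leq_addr.
rewrite in_fmove !in_pset qN (negbTE Ta) [_ == u]eq_sym (negbTE n4) eqxx !orbT !andbF /=.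
by clear - LT; lia.
Qed.

Lemma not_commute_medium t m k l : k < l -> l < t -> 2 ^ k <= m -> m < 2 ^ l ->
  ~ f_commute (2 ^ t + m) k l.
Proof.
move=> kl lt km mL.
have aL : 2 ^ k < 2 ^ l by rewrite ltn_exp2l.
have LT : 2 ^ l + 2 ^ l <= 2 ^ t by rewrite addnn -mul2n -expnS leq_exp2l.
have a0 : 0 < 2 ^ k by rewrite expn_gt0.
have [N EN] : exists N, N + m = 2 ^ l by exists (2 ^ l - m); rewrite subnK // ltnW.
have [u Eu] : exists u, 2 ^ l = u + 2 ^ k by exists (2 ^ l - 2 ^ k); rewrite subnK // ltnW.
have N0 : 0 < N by clear - EN mL; lia.
have NL : N <= 2 ^ l by clear - EN; lia.
have Nu : N <= u by clear - EN Eu km; lia.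
have LT' : 2 ^ l < 2 ^ t by clear - LT aL; lia.
have uT : u < 2 ^ t by clear - LT' Eu; lia.
have NT : N <= 2 ^ t by clear - NL LT'; lia.
have mT : m < 2 ^ t by clear - mL LT'; lia.
have Hn : 2 ^ k + 2 ^ l <= 2 ^ t + m by clear - km LT aL; lia.
pose X := pset N (2 ^ l) (2 ^ t).
have OX : odd_beads (2 ^ t + m) X by rewrite /X psetC; apply: top_pset; rewrite ?ltn_eqF.
have HA : hook_step l (2 ^ t + m) X (pset N 0 (2 ^ t)).
  apply: hook_step_pset; rewrite ?eqxx ?add0n //; try by rewrite ltn_eqF ?expn_gt0.
  by apply: row_pset => //; clear - EN LT'; lia.
have HB : hook_step k (2 ^ t + m) X (pset N u (2 ^ t)).
  apply: hook_step_pset; rewrite ?Nu ?orbT //; try by rewrite ltn_eqF.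
  have -> : 2 ^ t + m - 2 ^ k = 2 ^ t + (m - 2 ^ k) by clear - km; lia.
  rewrite psetC; apply: top_pset; rewrite ?ltn_eqF //; first by clear - mT; lia.
  by clear - EN Eu km; lia.
have nA : 2 ^ k <= 2 ^ t + m - 2 ^ l by clear - Hn; lia.
have nB : 2 ^ l <= 2 ^ t + m - 2 ^ k by clear - Hn; lia.
have [C HC] := hook_step_exists nA (hook_step_odd HA).
have [D HD] := hook_step_exists nB (hook_step_odd HB).
(* In [A] position 0 is filled and no later move empties it. In [B] the bead 2^l, the only one that
   a 2^l-move takes to 0, has already left. *)
apply: (not_commuteI Hn OX HA HC HB HD); apply: (@neq_fset _ _ 0).
have -> : 0 \in C.
  case: HC => y /and3P[_ ay _] [-> _]; rewrite in_fmove in_pset eqxx orbT andbT.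
  by clear - ay a0; lia.
case: HD => y /and3P[Hy Ly _] [-> _]; rewrite in_fmove in_pset [_ == u]ltn_eqF ?[_ == 2 ^ t]ltn_eqF.
- rewrite andbF orbF; move: Hy; rewrite in_pset => /or3P[/andP[_ Hy]|/eqP Hy|/eqP Hy].
  + by clear - Hy NL Ly; lia.
  + by clear - Hy Eu Ly a0; lia.
  + by clear - Hy LT'; lia.
- by clear - LT'; lia.
- by clear - N0 Nu; lia.
Qed.

(** The witness is the partition (2^t + r, 2^l) with beads 2^l and q. Again f_l first fills 0 for
    good, while f_k first moves the bead 2^l away and leaves 0 out of reach. *)
Lemma not_commute_two_rows t r k l : k < l -> l < t -> r.+1 < 2 ^ k ->
  ~ f_commute (2 ^ t + (2 ^ l + r)) k l.
Proof.
move=> kl lt rk.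
have aL : 2 ^ k < 2 ^ l by rewrite ltn_exp2l.
have LT : 2 ^ l + 2 ^ l <= 2 ^ t by rewrite addnn -mul2n -expnS leq_exp2l.
have LT' : 2 ^ l < 2 ^ t by clear - LT aL; lia.
pose q := 2 ^ t + r.+1; pose X := pset 1 (2 ^ l) q.
have Lq : 2 ^ l < q by clear - LT'; rewrite /q; lia.
have q0 : 0 < q := leq_ltn_trans (leq0n _) Lq.
set n := 2 ^ t + _.
have Hn : 2 ^ k + 2 ^ l <= n by rewrite /n; clear - LT aL; lia.
have qX : q \in X by rewrite in_pset eqxx !orbT.
have OX : odd_beads n X.
  apply: (@top_oddI t _ _ q); first by clear - rk aL LT; lia.
    rewrite /can_move qX leq_addr /= /q addKn notin_pset //; clear - rk aL LT; lia.
  have qL : q != 2 ^ l by rewrite eq_sym ltn_eqF.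
  rewrite {2}/q addKn /X psetC fmove_pset //.
  rewrite psetC; apply: top_pset; rewrite ?add1n ?expn_gt0 //; clear - rk aL; lia.
have HA : hook_step l n X (pset 1 0 q).
  apply: hook_step_pset; rewrite ?eqxx ?add0n ?expn_gt0 //; try by rewrite ltn_eqF.
  by apply: row_pset => //; rewrite /q /n; clear; lia.
have nA : 2 ^ k <= n - 2 ^ l by clear - Hn; lia.
have nB : 2 ^ l <= n - 2 ^ k by clear - Hn; lia.
have nk : 2 ^ k <= n by clear - Hn; lia.
have [C HC] := hook_step_exists nA (hook_step_odd HA).
have [B HB] := hook_step_exists nk OX.
have [D HD] := hook_step_exists nB (hook_step_odd HB).
apply: (not_commuteI Hn OX HA HC HB HD); apply: (@neq_fset _ _ 0).
have -> : 0 \in C.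
  case: HC => y /and3P[_ ay _] [-> _]; rewrite in_fmove in_pset eqxx orbT andbT.
  by clear - ay rk; lia.
have BE : B = pset 1 (2 ^ l - 2 ^ k) q.
  case: HB => y /and3P[Hy _ _] [EB OB]; rewrite EB in OB *.
  move: Hy; rewrite in_pset => /or3P[|/eqP Ey|/eqP Ey]; first by clear; lia.
    by rewrite Ey fmove_pset ?expn_gt0 // ltn_eqF.
  (* Had q been moved, r + 1 < 2^k would leave no bead at 2^t or above, and no 2^t-hook could be
     removed. *)
  have nT : 2 ^ t <= n - 2 ^ k by rewrite /n; clear - aL; lia.
  have [z /and3P[Hz Tz _] _] := odd_beads_child nT OB; exfalso.
  move: Hz; rewrite Ey in_fmove in_pset => /orP[/eqP Hz|/andP[zq /or3P[|/eqP Hz|/eqP Hz]]].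
  - by clear - Hz Tz rk LT aL; rewrite /q in Hz; lia.
  - by clear; lia.
  - by clear - Hz Tz LT'; lia.
  - by rewrite Hz eqxx in zq.
case: HD => y /and3P[Hy Ly _] [-> _]; rewrite BE in Hy *.
rewrite in_fmove in_pset /= [_ == 2 ^ l - 2 ^ k]ltn_eqF ?[_ == q]ltn_eqF ?subn_gt0 //.
  rewrite andbF orbF; move: Hy; rewrite in_pset => /or3P[|/eqP Hy|/eqP Hy].
  - by clear; lia.
  - by clear - Hy Ly aL rk; lia.
  - by clear - Hy Lq; lia.
Qed.

(** The witness is (2^t - 2, 2^l + 2^k, 1) with beads 1, q and 2^t. After f_k the bead 2^l + 1 is
    blocked by bead 1 and stays. After f_l it could only come from position q, which is empty since
    q < 2^t. *)
Lemma not_commute_three_rows t k l : k < l -> 2 ^ l + 2 ^ k + 1 < 2 ^ t ->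
  ~ f_commute (2 ^ t + (2 ^ l + (2 ^ k).-1)) k l.
Proof.
move=> kl LT.
have aL : 2 ^ k + 2 ^ k <= 2 ^ l by rewrite addnn -mul2n -expnS leq_exp2l.
have a0 : 0 < 2 ^ k by rewrite expn_gt0.
pose q := 2 ^ l + 2 ^ k + 1; pose X := pset 2 q (2 ^ t).
set n := 2 ^ t + _.
have Hn : 2 ^ k + 2 ^ l <= n by rewrite /n; clear - LT aL; lia.
have T2 : 1 < 2 ^ t by clear - LT a0; lia.
have OX : odd_beads n X.
  by rewrite /X psetC; apply: top_pset; rewrite ?ltn_eqF //; rewrite /q; clear - LT a0; lia.
have HA : hook_step l n X (pset 2 (2 ^ k + 1) (2 ^ t)).
  apply: hook_step_pset => //.
  - by rewrite /q; clear; lia.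
  - by rewrite /q; clear - a0; lia.
  - by rewrite ltn_eqF.
  - by rewrite addn1 ltnS a0 orbT.
  - by rewrite ltn_eqF //; clear - LT; lia.
  have -> : n - 2 ^ l = 2 ^ t + (2 ^ k).-1 by rewrite /n; clear; lia.
  by rewrite psetC; apply: top_pset; rewrite ?ltn_eqF //; clear - LT a0; lia.
have HB : hook_step k n X (pset 2 (2 ^ l + 1) (2 ^ t)).
  apply: hook_step_pset => //.
  - by rewrite /q; clear; lia.
  - by rewrite /q; clear - a0; lia.
  - by rewrite ltn_eqF.
  - by rewrite addn1 ltnS expn_gt0 orbT.
  - by rewrite ltn_eqF //; clear - LT; lia.
  have -> : n - 2 ^ k = 2 ^ t + (2 ^ l).-1 by rewrite /n; clear - a0 aL; lia.
  by rewrite psetC; apply: top_pset; rewrite ?ltn_eqF //; clear - LT a0 aL; lia.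
have nA : 2 ^ k <= n - 2 ^ l by clear - Hn; lia.
have nB : 2 ^ l <= n - 2 ^ k by clear - Hn; lia.
have [C HC] := hook_step_exists nA (hook_step_odd HA).
have [D HD] := hook_step_exists nB (hook_step_odd HB).
apply: (not_commuteI Hn OX HA HC HB HD); apply: (@neq_fset _ _ (2 ^ l + 1)).
have -> : 2 ^ l + 1 \in D.
  case: HD => y /and3P[Hy Ly Hn'] [-> _]; rewrite in_fmove in_pset eqxx orbT andbT.
  apply/orP; right; apply/negP => /eqP Ey; case/negP: Hn'.
  by rewrite -Ey addKn in_pset.
suff -> : 2 ^ l + 1 \in C = false by [].
have nA' z : z \in pset 2 (2 ^ k + 1) (2 ^ t) -> [\/ z = 1, z = 2 ^ k + 1 | z = 2 ^ t].
  rewrite in_pset => /or3P[H|/eqP|/eqP]; by [constructor 1; clear - H; lia|constructor 2|constructor 3].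
case: HC => y /and3P[/nA' Hy ay Hn'] [-> _]; apply/negbTE; rewrite in_fmove negb_or; apply/andP; split.
  case: Hy => Hy; rewrite Hy in ay Hn' *.
  - by clear - aL a0; lia.
  - by rewrite addKn in_pset in Hn'.
  - by clear - LT; lia.
apply/negP => /andP[_ /nA' H]; case: H => H; clear - H aL a0 LT; lia.
Qed.

(** The families are chosen by the size of m: below 2^l, at least 2^k + 2^l, or in between, where r
    = m - 2^l is below 2^k - 1 or equal to it. *)
Lemma not_commute t m k l : m < 2 ^ t -> k < l -> l < t -> 2 ^ k <= m ->
  ~ [/\ 2 ^ t + m = 6, k = 0 & l = 1] -> ~ f_commute (2 ^ t + m) k l.
Proof.
move=> mT kl lt km exc.
have [mL|Lm] := ltnP m (2 ^ l); first exact: not_commute_medium.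
have [large|small] := leqP (2 ^ k + 2 ^ l) m; first exact: not_commute_large.
have [r Em] : exists r, m = 2 ^ l + r by exists (m - 2 ^ l); rewrite subnKC.
have [rk|kr] := ltnP r.+1 (2 ^ k); first by rewrite Em; apply: not_commute_two_rows.
have Er : r = (2 ^ k).-1 by clear - Em small kr; lia.
(* The condition 2^l + 2^k + 1 < 2^t fails only for k = 0, l = 1, t = 2, that is, for n = 6. *)
rewrite Em Er; apply: not_commute_three_rows => //.
have LT : 2 ^ l + 2 ^ l <= 2 ^ t by rewrite addnn -mul2n -expnS leq_exp2l.
case: k kl {km} kr Er exc {small} => [|k] kl kr Er exc; last first.
  have aL : 2 ^ k.+1 + 2 ^ k.+1 <= 2 ^ l by rewrite addnn -mul2n -expnS leq_exp2l.
  have a2 : 2 <= 2 ^ k.+1 by rewrite -{1}[2]/(2 ^ 1) leq_exp2l.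
  by clear - LT aL a2; lia.
case: l kl lt Em LT exc {mT Lm} => [//|[|l]] kl lt Em LT exc; last first.
  have : 2 ^ 2 <= 2 ^ l.+2 by rewrite leq_exp2l.
  by clear - LT; lia.
have [//|le] := ltnP (2 ^ 1 + 2 ^ 0 + 1) (2 ^ t).
case: exc; split=> //; rewrite Em Er /=.
by move: LT le; clear; lia.
Qed.

End Counterexamples.

(** * The case n = 6 by computation *)

Section Exceptional.
Implicit Types (la : seq nat) (n k mx : nat).

(* [odd_partition] and [f] refer to characters and do not compute. *)
Definition odd_partition_comp n la := is_partition n la && odd_beads n (beads (size la) la).

Definition f_comp n k la : seq nat :=
  head [::]
    [seq remove_hook la b | b <- boxes la
       & (hook_length la b == 2 ^ k)
         && odd_partition_comp (n - 2 ^ k) (remove_hook la b)].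

Lemma f_compE n k la : f n k la = f_comp n k la.
Proof.
rewrite /f /f_comp; congr (head _ (map _ _)); apply: eq_filter => b.
by rewrite (odd_partitionE _ (leqnn _)).
Qed.

(** [mx] bounds the largest part; [fuel] makes the recursion structural, and n units are enough. *)
Fixpoint partitions fuel mx n : seq (seq nat) :=
  if n is 0 then [:: [::]] else
  if fuel is fuel'.+1 then
    flatten [seq [seq a :: s | s <- partitions fuel' a (n - a)] | a <- iota 1 (minn mx n)]
  else [::].

Lemma mem_partitions fuel mx n la : n <= fuel -> path geq mx la -> 0 \notin la ->
  sumn la = n -> la \in partitions fuel mx n.
Proof.
elim: fuel mx n la => [|fuel IH] mx n [|a la] /=.
- by move=> _ _ _ <-.
- by rewrite leqn0 => /eqP -> _; rewrite inE negb_or; lia.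
- by move=> _ _ _ <-.
move=> nf /andP[amx Hp]; rewrite inE negb_or => /andP[a0 H0] Hn.
case: n nf Hn => [|n] nf Hn; first by move: a0; lia.
apply/flattenP; exists [seq a :: s | s <- partitions fuel a (n.+1 - a)].
  by apply: map_f; rewrite mem_iota; move: amx; rewrite /=; lia.
by apply: map_f; apply: IH => //; lia.
Qed.

Lemma f_commute_exceptional : f_commute 6 0 1.
Proof.
move=> la Hla; have Hp := Hla; rewrite (odd_partitionE _ (leqnn _)) in Hp.
have in_la : la \in partitions 6 6 6.
  case/andP: Hp => /and3P[Hs H0 /eqP Hn] _; apply: mem_partitions => //.
  case: la Hs Hn {Hla H0} => //= a la Hs Hn; rewrite Hs andbT; lia.
rewrite !f_compE; apply/eqP.
have Hall : all (fun la => odd_partition_comp 6 la ==>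
   (f_comp (6 - 2 ^ 1) 0 (f_comp 6 1 la) == f_comp (6 - 2 ^ 0) 1 (f_comp 6 0 la)))
   (partitions 6 6 6) by vm_compute.
by have /implyP := allP Hall _ in_la; apply.
Qed.

End Exceptional.

Theorem theorem2 (n t m k l : nat)
    (n_def : n = 2 ^ t + m) (m_lt : m < 2 ^ t)
    (k_lt_l : k < l) (l_le_t : l <= t) (kl_le_n : 2 ^ k + 2 ^ l <= n) :
  let exceptional := n = 6 /\ k = 0 /\ l = 1 in
  let equivalence := f_commute n k l <-> (m < 2 ^ k \/ l = t) in
  (~ exceptional -> equivalence) /\ (exceptional -> ~ equivalence).
Proof.
split=> [Hexc|[n6 [k0 l1]] [H _]].
  split=> [Hc|[mk|lt]]; last 2 first.
  - move: l_le_t; rewrite leq_eqVlt => /orP[/eqP lt|lt].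
      by subst l; apply: (f_commute_top n_def m_lt).
    exact: (f_commute_small n_def mk).
  - by subst l; apply: (f_commute_top n_def m_lt).
  have [mk|km] := ltnP m (2 ^ k); first by left.
  right; apply/eqP; rewrite eqn_leq l_le_t /= leqNgt; apply/negP => lt.
  subst n; apply: (not_commute m_lt k_lt_l lt km) Hc => -[E1 E2 E3].
  by apply: Hexc.
(* The maps commute here, but n = 6 is incompatible with m = 0 and with t = 1, so both alternatives
   on the right fail. *)
subst k l; have := H; rewrite n6 => /(_ f_commute_exceptional) [|Et].
  rewrite expn0 ltnS leqn0 => /eqP m0; have : 2 ^ t = 6 by rewrite -n6 n_def m0 addn0.
  by case: t {n_def m_lt l_le_t H} => [|[|[|t]]] //; rewrite !expnS; lia.
by subst t; move: m_lt n_def; rewrite n6 expn1; lia.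
Qed.
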